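(* Exact self-embezzlement is possible in the commuting-operator model: there exist a Hilbert space $\mathcal{H}$; unital C*-subalgebras $\mathcal{A}_1,\mathcal{B}_1,\mathcal{A}_2,\mathcal{B}_2\subseteq B(\mathcal{H})$ that pairwise commute (the algebras of registers $\mathsf{A}_1,\mathsf{B}_1,\mathsf{A}_2,\mathsf{B}_2$); a unit vector $\psi\in\mathcal{H}$; a unitary $U_A$ acting on register $(\mathsf{A}_1,\mathsf{A}_2)$ and a unitary $U_B$ acting on register $(\mathsf{B}_1,\mathsf{B}_2)$ with $U_AU_B=U_BU_A$; such that, with $\psi'=U_AU_B\psi$: (0) the state of $(\mathsf{A}_1,\mathsf{B}_1)$ maximally violates CHSH: there exist self-adjoint $a_0,a_1\in\mathcal{A}_1$, $b_0,b_1\in\mathcal{B}_1$ of norm at most $1$ with $\langle\psi,(a_0b_0+a_0b_1+a_1b_0-a_1b_1)\psi\rangle=2\sqrt2$; (1) $\psi$ is a product state over $(\mathsf{A}_1,\mathsf{B}_1)$, $\mathsf{A}_2$, $\mathsf{B}_2$: for all $X\in\overline{\mathcal{A}_1\cup\mathcal{B}_1}$, $Y\in\mathcal{A}_2$, $Z\in\mathcal{B}_2$, $\langle\psi,XYZ\psi\rangle=\langle\psi,X\psi\rangle\langle\psi,Y\psi\rangle\langle\psi,Z\psi\rangle$; (2) register $(\mathsf{A}_1,\mathsf{B}_1)$ is unchanged: $\langle\psi,X\psi\rangle=\langle\psi',X\psi'\rangle$ for all $X\in\overline{\mathcal{A}_1\cup\mathcal{B}_1}$; (3) there exist unitaries $W_A$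 acting on register $(\mathsf{A}_1,\mathsf{A}_2)$ and $W_B$ acting on register $(\mathsf{B}_1,\mathsf{B}_2)$ with $W_A^*\mathcal{A}_1W_A=\mathcal{A}_2$, $W_B^*\mathcal{B}_1W_B=\mathcal{B}_2$, and $\langle\psi',XY\psi'\rangle=\langle\psi',(W_A^*XW_A)(W_B^*YW_B)\psi'\rangle$ for all $X\in\mathcal{A}_1$, $Y\in\mathcal{B}_1$.
   Context: For a compound register $(\mathsf{R}_{k_1},\dots,\mathsf{R}_{k_\ell})$ among registers with pairwise commuting algebras $\mathcal{A}_1,\dots,\mathcal{A}_m\subseteq B(\mathcal{H})$, its algebra is $\mathcal{A}_{(k_1,\dots,k_\ell)}=\overline{\mathcal{A}_{k_1}\cup\cdots\cup\mathcal{A}_{k_\ell}}$, the C*-algebra generated by these. A unitary $U\in B(\mathcal{H})$ acts on register $(\mathsf{R}_{k_1},\dots,\mathsf{R}_{k_\ell})$ if (i) $U^*AU=A$ for every $A\in\mathcal{A}_j$ with $j\notin\{k_1,\dots,k_\ell\}$, and (ii) $U^*\mathcal{A}_{(k_1,\dots,k_\ell)}U=\mathcal{A}_{(k_1,\dots,k_\ell)}$. Here the four registers are $\mathsf{A}_1,\mathsf{B}_1,\mathsf{A}_2,\mathsf{B}_2$ with algebras $\mathcal{A}_1,\mathcal{B}_1,\mathcal{A}_2,\mathcal{B}_2$. *)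

(* Defs.v *)
From mathcomp Require Import all_boot all_order all_algebra.
From mathcomp Require Import reals complex.
Set Implicit Arguments. Unset Strict Implicit. Unset Printing Implicit Defensive.
Import GRing.Theory Num.Theory.
Local Open Scope ring_scope.

Section Hilbert.
Variable R : realType.
Local Notation C := R[i].
Variable H : lmodType C.
Variable ip : H -> H -> C.

Definition inner_product : Prop :=
  [/\ forall (a : C) (x y z : H), ip x (a *: y + z) = a * ip x y + ip x z,
      forall x y, ip y x = (ip x y)^*,
      forall x, 0 <= ip x x &
      forall x, ip x x = 0 -> x = 0].

Definition hnorm (x : H) : R := Num.sqrt (complex.Re (ip x x)).

Definition hcauchy (u : nat -> H) : Prop :=
  forall eps : R, 0 < eps -> exists N : nat,
    forall m n, (N <= m)%N -> (N <= n)%N -> hnorm (u m - u n) < eps.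

Definition hconverges (u : nat -> H) (l : H) : Prop :=
  forall eps : R, 0 < eps -> exists N : nat,
    forall n, (N <= n)%N -> hnorm (u n - l) < eps.

Definition hilbert_space : Prop :=
  inner_product /\ forall u, hcauchy u -> exists l, hconverges u l.

Definition bounded_op (T : H -> H) : Prop :=
  (forall (a : C) x y, T (a *: x + y) = a *: T x + T y) /\
  exists M : R, forall x, hnorm (T x) <= M * hnorm x.

Definition is_adjoint (T S : H -> H) : Prop :=
  forall x y, ip x (T y) = ip (S x) y.

Definition unitary (U Us : H -> H) : Prop :=
  [/\ bounded_op U, bounded_op Us, is_adjoint U Us,
      forall x, Us (U x) = x & forall x, U (Us x) = x].

Definition opset := (H -> H) -> Prop.

Definition seteq (A B : opset) : Prop := forall T, A T <-> B T.

Definition opunion (A B : opset) : opset := fun T => A T \/ B T.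

Definition op_conv (Tn : nat -> H -> H) (T : H -> H) : Prop :=
  forall eps : R, 0 < eps -> exists N : nat,
    forall n, (N <= n)%N -> forall x, hnorm (Tn n x - T x) <= eps * hnorm x.

Definition cstar_subalg (A : opset) : Prop :=
  [/\ forall T, A T -> bounded_op T,
      A id,
      [/\ forall S T, A S -> A T -> A (fun x => S x + T x),
           forall (a : C) T, A T -> A (fun x => a *: T x) &
           forall S T, A S -> A T -> A (S \o T)],
      forall T, A T -> (exists S, A S /\ is_adjoint T S) &
      forall Tn T, (forall n, A (Tn n)) -> bounded_op T -> op_conv Tn T -> A T].

Definition cstar_gen (S : opset) : opset :=
  fun T => forall A, cstar_subalg A -> (forall X, S X -> A X) -> A T.

Definition commute_sets (A B : opset) : Prop :=
  forall X Y, A X -> B Y -> X \o Y = Y \o X.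

Definition conj_img (Us U : H -> H) (A : opset) : opset :=
  fun T => exists X, A X /\ T = Us \o X \o U.

(* U (with adjoint Us) acts on the compound register (K1,K2), the remaining
   registers having algebras O1, O2 *)
Definition acts_on (U Us : H -> H) (K1 K2 O1 O2 : opset) : Prop :=
  (forall X, O1 X \/ O2 X -> Us \o X \o U = X) /\
  seteq (conj_img Us U (cstar_gen (opunion K1 K2))) (cstar_gen (opunion K1 K2)).

End Hilbert.

(* Main.v *)
Require Import Defs.
From HB Require Import structures.
From mathcomp Require Import all_boot all_order all_algebra.
From mathcomp Require Import finmap ring lra.
From mathcomp Require Import boolp classical_sets functions reals complex.
From mathcomp Require Import topology normedtype.
Set Implicit Arguments. Unset Strict Implicit. Unset Printing Implicit Defensive.
Import Order.TTheory GRing.Theory Num.Theory numFieldNormedType.Exports.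
Local Open Scope fset_scope.
Local Open Scope ring_scope.

(** Each register holds infinitely many qubits.  In register 1 half of the qubits
of Alice are paired in Bell states with qubits of Bob, and every other qubit of
either party, in particular all of register 2, is maximally mixed and
uncorrelated.  A bijection of infinite sets of qubits, applied by both parties
alike, moves every other Bell pair to register 2 and refills register 1 with
the rest of the pairs, so that afterwards both registers look like register 1 at
the start.  Applied by one party alone, the permutation changes infinitely many
correlations and is not implemented on the GNS space of the state.  Therefore
the Hilbert space is the direct sum of GNS spaces over all ways of assigning
positions to the qubits of both parties: permuting the assignments is unitary.

Everything is a signed permutation of the basis of some l2 space.  The state of a
word in Pauli operators is a sign or 0, depends on the positions only up to an
injective renaming and is multiplicative over disjoint sets of positions; by
linearity and continuity this passes to the generated C*-algebras. *)

(** * Square-summable families *)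

Section UnconditionalSum.
Variables (R : realType) (T : choiceType).
Implicit Types (f g : T -> R) (A B : {fset T}) (l : R).

(** Convergence along the directed set of finite subsets: the index set of the model is uncountable
    and has no enumeration. *)
Definition hassum f l := forall e : R, 0 < e ->
  exists A, forall B, A `<=` B -> `|\sum_(i <- B) f i - l| < e.

Definition summable f := exists l, hassum f l.

Definition rsum f : R := xget 0 [set l | hassum f l]%classic.

Lemma hassum_unique f l l' : hassum f l -> hassum f l' -> l = l'.
Proof.
move=> hl hl'; apply/eqP; rewrite -subr_eq0; apply: contraT => ne0.
have e0 : 0 < `|l - l'| / 2 by rewrite divr_gt0 ?normr_gt0.
have [A hA] := hl _ e0; have [B hB] := hl' _ e0.
have h1 := hA _ (fsubsetUl A B); have h2 := hB _ (fsubsetUr A B).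
move: h1 h2; set s := \sum_(i <- _) _ => h1 h2.
have : `|l - l'| <= `|s - l| + `|s - l'|.
  rewrite (distrC s l); apply: le_trans (ler_normD _ _).
  by rewrite addrA subrK.
lra.
Qed.

Lemma rsumE f l : hassum f l -> rsum f = l.
Proof. by move=> h; apply: xget_unique => // l' /hassum_unique; exact. Qed.

Lemma rsumP f : summable f -> hassum f (rsum f).
Proof. by case=> l h; rewrite (rsumE h). Qed.

Lemma hassumD f g l l' : hassum f l -> hassum g l' ->
  hassum (fun i => f i + g i) (l + l').
Proof.
move=> hf hg e e0; have e2 : 0 < e / 2 by rewrite divr_gt0.
have [A hA] := hf _ e2; have [B hB] := hg _ e2.
exists (A `|` B) => C; rewrite fsubUset => /andP[/hA h1 /hB h2].
rewrite big_split /= opprD addrACA (le_lt_trans (ler_normD _ _)) //; lra.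
Qed.

Lemma hassumZ (c : R) f l : hassum f l -> hassum (fun i => c * f i) (c * l).
Proof.
move=> hf e e0; have c0 : 0 < `|c| + 1 by rewrite ltr_wpDl.
have [A hA] := hf _ (divr_gt0 e0 c0); exists A => B /hA.
rewrite -mulr_sumr -mulrBr normrM ltr_pdivlMr // => h.
apply: le_lt_trans h; rewrite mulrC ler_wpM2l //; lra.
Qed.

Lemma ler_sum_fset f A B : (forall i, 0 <= f i) -> A `<=` B ->
  \sum_(i <- A) f i <= \sum_(i <- B) f i.
Proof.
move=> f0 AB; pose h i := if i \in A then f i else 0.
have -> : \sum_(i <- A) f i = \sum_(i <- A) h i.
  by apply: eq_big_seq => i; rewrite /h => ->.
rewrite (big_fset_incl _ AB) /h; last by move=> i _ /negbTE ->.
by apply: ler_sum => i _; case: ifP.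
Qed.

(** Finite partial sums increase with the set, so their supremum is the limit. *)
Lemma summable_ge0 f (M : R) : (forall i, 0 <= f i) ->
  (forall A, \sum_(i <- A) f i <= M) -> summable f.
Proof.
move=> f0 fM; pose S := [set s | exists A, s = \sum_(i <- A) f i]%classic.
have hS : has_sup S.
  by split; [exists (\sum_(i <- fset0) f i), fset0 | exists M => _ [A ->]].
exists (sup S) => e e0.
have [_ [A ->] hA] := sup_adherent e0 hS.
exists A => B AB.
have hB : \sum_(i <- B) f i <= sup S by apply: sup_upper_bound => //; exists B.
have := ler_sum_fset f0 AB.
rewrite ler0_norm ?subr_le0 //; lra.
Qed.

Lemma ler_sum_rsum f A : (forall i, 0 <= f i) -> summable f ->
  \sum_(i <- A) f i <= rsum f.
Proof.
move=> f0 /rsumP h; apply/ler_addgt0Pr => e e0.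
have [B hB] := h _ e0; have := hB _ (fsubsetUr A B).
rewrite ltr_norml => /andP[_]; rewrite ltrBlDl => /ltW h1.
rewrite (le_trans _ h1) //.
exact: ler_sum_fset (fsubsetUl A B).
Qed.

Lemma rsum_le f (M : R) : summable f -> (forall A, \sum_(i <- A) f i <= M) ->
  rsum f <= M.
Proof.
move=> /rsumP h hM; apply/ler_addgt0Pr => e e0.
have [A hA] := h _ e0; have := hA _ (fsubset_refl A); have := hM A.
by rewrite ltr_norml => h1 /andP[h2 _]; lra.
Qed.

Lemma hassum_single f i0 : (forall i, i != i0 -> f i = 0) -> hassum f (f i0).
Proof.
move=> h e e0; exists [fset i0] => B hB.
rewrite -(big_fset_incl _ hB) ?big_seq_fset1 ?subrr ?normr0 // => i _.
by rewrite inE => /h.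
Qed.

End UnconditionalSum.

Section ComplexSum.
Variables (R : realType) (T : choiceType).
Local Notation C := R[i].
Implicit Types (F G : T -> C).

Definition csummable F :=
  summable (fun i => complex.Re (F i)) /\ summable (fun i => complex.Im (F i)).

Definition csum F : C :=
  Complex (rsum (fun i => complex.Re (F i))) (rsum (fun i => complex.Im (F i))).

Lemma csumD F G : csummable F -> csummable G ->
  csum (fun i => F i + G i) = csum F + csum G.
Proof.
move=> [/rsumP a /rsumP b] [/rsumP c /rsumP d]; apply/eqP; rewrite eq_complex /=.
apply/andP; split; apply/eqP; apply: rsumE; [have := hassumD a c|have := hassumD b d];
  by congr hassum; apply: funext => i; case: (F i) (G i) => [? ?] [? ?].
Qed.

Lemma csumZ (z : C) F : csummable F ->
  csum (fun i => z * F i) = z * csum F.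
Proof.
move=> [/rsumP a /rsumP b]; case: z => x y; apply/eqP; rewrite eq_complex /=.
apply/andP; split; apply/eqP; apply: rsumE.
  have := hassumD (hassumZ x a) (hassumZ (- y) b); rewrite mulNr.
  by congr hassum; apply: funext => i; case: (F i) => ? ? /=; rewrite mulNr.
have := hassumD (hassumZ x b) (hassumZ y a).
by congr hassum; apply: funext => i; case: (F i).
Qed.

Lemma csum_conj F : csummable F -> csum (fun i => (F i)^*) = (csum F)^*.
Proof.
move=> [/rsumP a /rsumP b]; apply/eqP; rewrite eq_complex /=.
apply/andP; split; apply/eqP; last rewrite -mulN1r; apply: rsumE.
  by move: a; congr hassum; apply: funext => i; case: (F i).
move: (hassumZ (-1) b); congr hassum; apply: funext => i.
by case: (F i) => ? ? /=; rewrite mulN1r.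
Qed.

Lemma csum_single F i0 : (forall i, i != i0 -> F i = 0) -> csum F = F i0.
Proof.
move=> h; have E := complexE (F i0); apply/eqP; rewrite eq_complex /=.
by apply/andP; split; apply/eqP; apply: rsumE;
  apply: (@hassum_single _ _ (fun i => _ (F i))) => i /h ->.
Qed.

End ComplexSum.

Section SquareSummable.
Variables (R : realType) (T : choiceType).
Local Notation C := R[i].
Implicit Types (f g : T -> C) (A B : {fset T}).

(** The squared modulus takes values in [R], so that bounds live in a total order; the order of
    [R[i]] is only partial. *)
Definition cnsq (z : C) : R := complex.Re z ^+ 2 + complex.Im z ^+ 2.

Lemma cnsq_ge0 z : 0 <= cnsq z.
Proof. by rewrite addr_ge0 ?sqr_ge0. Qed.

Lemma cnsqM z w : cnsq (z * w) = cnsq z * cnsq w.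
Proof. by case: z w => [a b] [c d]; rewrite /cnsq /=; ring. Qed.

Lemma cnsqD z w : cnsq (z + w) <= 2 * cnsq z + 2 * cnsq w.
Proof.
case: z w => [a b] [c d]; rewrite /cnsq /=.
have := sqr_ge0 (a - c); have := sqr_ge0 (b - d); nra.
Qed.

Lemma cnsq_eq0 z : cnsq z = 0 -> z = 0.
Proof.
move=> /eqP; rewrite paddr_eq0 ?sqr_ge0 // !sqrf_eq0 => /andP[/eqP a /eqP b].
by apply/eqP; rewrite eq_complex a b /= eqxx.
Qed.

Definition square_summable f := exists M : R, forall A, \sum_(i <- A) cnsq (f i) <= M.

Definition l2_pred : {pred T -> C} := fun f => `[< square_summable f >].

Lemma l2_pred_submod : submod_closed l2_pred.
Proof.
split.
  apply/asboolP; exists 0 => A; rewrite big1 // => i _.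
  by rewrite /cnsq /= expr0n addr0.
move=> a f g /asboolP[M hM] /asboolP[N hN]; apply/asboolP.
exists (2 * (cnsq a * M) + 2 * N) => A.
apply: (@le_trans _ _ (\sum_(i <- A) (2 * (cnsq a * cnsq (f i)) + 2 * cnsq (g i)))).
  by apply: ler_sum => i _; rewrite -cnsqM; apply: cnsqD.
rewrite big_split /= -!mulr_sumr lerD // ler_wpM2l //.
by rewrite ler_wpM2l ?cnsq_ge0.
Qed.

HB.instance Definition _ :=
  GRing.isSubmodClosed.Build R[i] (T -> R[i]) l2_pred l2_pred_submod.

Record l2 := L2 { l2_fun :> T -> C; l2P : l2_fun \in l2_pred }.

HB.instance Definition _ := [isSub for l2_fun].
HB.instance Definition _ := [Choice of l2 by <:].
HB.instance Definition _ := [SubChoice_isSubLmodule of l2 by <:].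

End SquareSummable.

(** * The Hilbert space of square-summable families *)

Section L2Hilbert.
Variables (R : realType) (T : choiceType).
Local Notation C := R[i].
Local Notation H := (l2 R T).
Implicit Types (f g : H) (A B : {fset T}).

Definition l2_ip f g : C := csum (fun i => (f i)^* * g i).

Lemma l2_summable f : summable (fun i => cnsq (f i)).
Proof.
have /asboolP[M hM] := l2P f.
by apply: (summable_ge0 (M := M)) => // i; apply: cnsq_ge0.
Qed.

(** Polarization: the real part of each term is a quarter of the difference of the squared moduli of
    [f + g] and [f - g]. The imaginary part is the real part for [- 'i%C *: g]. *)
Lemma l2_csummable f g : csummable (fun i => (f i)^* * g i).
Proof.
have summableRe g' : summable (fun i => complex.Re ((f i)^* * g' i)).
  have [a ha] := l2_summable (f + g'); have [b hb] := l2_summable (f - g').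
  exists (4^-1 * a + (- 4^-1) * b).
  move: (hassumD (hassumZ 4^-1 ha) (hassumZ (- 4^-1) hb)).
  congr hassum; apply: funext => i.
  have -> : (f + g') i = f i + g' i by [].
  have -> : (f - g') i = f i - g' i by [].
  by rewrite /cnsq; case: (f i) (g' i) => [a1 b1] [a2 b2] /=; field.
split=> //; have := summableRe (- 'i%C *: g).
congr summable; apply: funext => i; have -> : (- 'i%C *: g) i = - 'i%C * g i by [].
by case: (f i) (g i) => [a1 b1] [a2 b2] /=; ring.
Qed.

Lemma l2_ipxx f : l2_ip f f = Complex (rsum (fun i => cnsq (f i))) 0.
Proof.
apply/eqP; rewrite eq_complex /=; apply/andP; split; apply/eqP.
  by congr rsum; apply: funext => i; rewrite /cnsq; case: (f i) => a b /=; ring.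
apply: rsumE => e e0; exists fset0 => B _; rewrite big1 ?subrr ?normr0 // => i _.
by case: (f i) => a b /=; ring.
Qed.

Lemma l2_inner_product : inner_product l2_ip.
Proof.
split.
- move=> a x y z; rewrite /l2_ip -csumZ -?csumD; try exact: l2_csummable.
    congr csum; apply: funext => i.
    have -> : (a *: y + z) i = a * y i + z i by [].
    by rewrite mulrDr mulrCA.
  have := l2_csummable x (a *: y); congr csummable; apply: funext => i.
  by rewrite mulrCA.
- move=> x y; rewrite /l2_ip -csum_conj; last exact: l2_csummable.
  congr csum; apply: funext => i; case: (x i) (y i) => [a b] [c d].
  by apply/eqP; rewrite eq_complex /=; apply/andP; split; apply/eqP; ring.
- move=> x; rewrite l2_ipxx lecE /= eqxx /=.
  have := ler_sum_rsum fset0 (fun i => cnsq_ge0 (x i)) (l2_summable x).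
  by rewrite big_seq_fset0.
move=> x; rewrite l2_ipxx => -[h]; apply: val_inj; apply: funext => i.
apply: cnsq_eq0; apply/eqP; rewrite eq_le cnsq_ge0 andbT -h.
have := ler_sum_rsum [fset i] (fun i => cnsq_ge0 (x i)) (l2_summable x).
by rewrite big_seq_fset1.
Qed.

Lemma l2_hnorm2 f : hnorm l2_ip f ^+ 2 = rsum (fun i => cnsq (f i)).
Proof.
rewrite /hnorm sqr_sqrtr l2_ipxx //=.
have := ler_sum_rsum fset0 (fun i => cnsq_ge0 (f i)) (l2_summable f).
by rewrite big_seq_fset0.
Qed.

Lemma l2_sum_le f A : \sum_(i <- A) cnsq (f i) <= hnorm l2_ip f ^+ 2.
Proof.
by rewrite l2_hnorm2; apply: ler_sum_rsum (l2_summable f) => i; apply: cnsq_ge0.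
Qed.

Lemma l2_coord_le f i : cnsq (f i) <= hnorm l2_ip f ^+ 2.
Proof. by have := l2_sum_le f [fset i]; rewrite big_seq_fset1. Qed.

Local Open Scope classical_set_scope.

Lemma cauchy_real_cvg (u : nat -> R) :
  (forall e : R, 0 < e -> exists N : nat,
    forall m n, (N <= m)%N -> (N <= n)%N -> `|u m - u n| < e) ->
  exists l : R, u n @[n --> \oo] --> l.
Proof.
move=> h; suff : cvgn u by move=> cu; exists (limn u).
apply/cauchy_cvgP/cauchy_exP => e e0; have [N hN] := h _ e0.
by exists (u N); exists N => // n /= Nn; rewrite /ball /= hN.
Qed.

Lemma cvg_sum_fset (F : T -> nat -> R) (l : T -> R) A :
  (forall i, F i n @[n --> \oo] --> l i) ->
  \sum_(i <- A) F i n @[n --> \oo] --> \sum_(i <- A) l i.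
Proof.
move=> h; elim: (enum_fset A) => [|a s IH].
  by rewrite big_nil; under eq_fun do rewrite big_nil; apply: cvg_cst.
by rewrite big_cons; under eq_fun do rewrite big_cons; apply: cvgD.
Qed.

(** Coordinates converge because the norm dominates them. The Cauchy estimate, restricted to
    finitely many coordinates, survives the limit in one index, with a bound independent of the
    finite set. *)
Lemma l2_complete (u : nat -> H) : hcauchy l2_ip u -> exists l, hconverges l2_ip u l.
Proof.
move=> hu.
have coord (part : C -> R) : (forall z w, part z - part w = part (z - w)) ->
    (forall z, part z ^+ 2 <= cnsq z) -> forall i, exists l : R, part (u n i) @[n --> \oo] --> l.
  move=> partB part_le i; apply: cauchy_real_cvg => e e0; have [N hN] := hu _ e0.
  exists N => m n hm hn; rewrite partB.
  have -> : u m i - u n i = (u m - u n) i by [].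
  rewrite -(ltr_pXn2r (n := 2)) ?nnegrE ?(ltW e0) //.
  rewrite real_normK ?num_real //.
  apply: le_lt_trans (part_le _) _; apply: le_lt_trans (l2_coord_le _ _) _.
  by rewrite ltr_pXn2r ?nnegrE ?(ltW e0) ?sqrtr_ge0 // hN.
have /choice[lim_re hre] : forall i, exists l : R, complex.Re (u n i) @[n --> \oo] --> l.
  apply: coord => [[? ?] [? ?] //|[a b]].
  by rewrite /cnsq /= lerDl sqr_ge0.
have /choice[lim_im him] : forall i, exists l : R, complex.Im (u n i) @[n --> \oo] --> l.
  apply: coord => [[? ?] [? ?] //|[a b]].
  by rewrite /cnsq /= lerDr sqr_ge0.
pose l i := Complex (lim_re i) (lim_im i).
have fatou (e : R) : 0 < e -> exists N, forall n, (N <= n)%N -> forall A,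
    \sum_(i <- A) cnsq (u n i - l i) <= e ^+ 2.
  move=> e0; have [N hN] := hu _ e0; exists N => n hn A.
  have cv : \sum_(i <- A) cnsq (u n i - u m i) @[m --> \oo] -->
            \sum_(i <- A) cnsq (u n i - l i).
    apply: cvg_sum_fset => i; rewrite /cnsq.
    have E z w : complex.Re (z - w) = complex.Re z - complex.Re w :> R.
      by case: z w => [? ?] [? ?].
    have E' z w : complex.Im (z - w) = complex.Im z - complex.Im w :> R.
      by case: z w => [? ?] [? ?].
    rewrite E E'; under eq_fun do rewrite E E'.
    by apply: cvgD; apply: cvgM; apply: cvgB => //; apply: cvg_cst.
  rewrite -(cvg_lim _ cv) //; apply: limr_le; first exact: cvgP cv.
  exists N => // m /= hm.
  apply: le_trans (l2_sum_le (u n - u m) A) _.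
  by rewrite ler_pXn2r ?nnegrE ?(ltW e0) ?sqrtr_ge0 // ltW // hN.
have lP : l \in @l2_pred R T.
  have [N hN] := fatou 1 ltr01.
  (* [l] is [u N] minus [u N - l], and the latter is controlled by [fatou] at 1. *)
  apply/asboolP; exists (2 * hnorm l2_ip (u N) ^+ 2 + 2 * (1 ^+ 2)) => A.
  apply: (@le_trans _ _ (\sum_(i <- A) (2 * cnsq (u N i) + 2 * cnsq (u N i - l i)))).
    apply: ler_sum => i _; rewrite -[l i](subKr (u N i)).
    apply: le_trans (cnsqD _ _) _; rewrite subKr lerD2l.
    by rewrite /cnsq; case: (u N i) (l i) => [? ?] [? ?] /=; rewrite !sqrrN.
  rewrite big_split /= -!mulr_sumr lerD // ler_wpM2l //; first exact: l2_sum_le.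
  exact: hN.
(* Half of [e], since finite sums yield only a weak inequality. *)
exists (L2 lP) => e e0; have e2 : 0 < e / 2 by rewrite divr_gt0.
have [N hN] := fatou _ e2; exists N => n hn.
suff : hnorm l2_ip (u n - L2 lP) <= e / 2 by move=> h; lra.
rewrite -(ler_pXn2r (n := 2)) ?nnegrE ?(ltW e2) ?sqrtr_ge0 // l2_hnorm2.
by apply: rsum_le (hN n hn); apply: (l2_summable (u n - L2 lP)).
Qed.

Lemma l2_hilbert : hilbert_space l2_ip.
Proof. split; [exact: l2_inner_product | exact: l2_complete]. Qed.

End L2Hilbert.

(** * Operators on a Hilbert space *)

Section InnerProduct.
Variables (R : realType) (H : lmodType R[i]) (ip : H -> H -> R[i]).
Hypothesis ip_inner : inner_product ip.
Local Notation N := (hnorm ip).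

Lemma ip_conj x y : ip y x = (ip x y)^*.
Proof. by have [] := ip_inner. Qed.

Lemma ip0r x : ip x 0 = 0.
Proof.
have [h _ _ _] := ip_inner; have := h 1 x 0 0.
rewrite scaler0 addr0 mul1r => /eqP; rewrite -subr_eq0 opprD addrA subrr sub0r.
by rewrite oppr_eq0 => /eqP.
Qed.

Lemma ipDr x y z : ip x (y + z) = ip x y + ip x z.
Proof. by have [h _ _ _] := ip_inner; have := h 1 x y z; rewrite scale1r mul1r. Qed.

Lemma ipZr x a y : ip x (a *: y) = a * ip x y.
Proof. by have [h _ _ _] := ip_inner; have := h a x y 0; rewrite ip0r !addr0. Qed.

Lemma ipBr x y z : ip x (y - z) = ip x y - ip x z.
Proof. by rewrite ipDr -scaleN1r ipZr mulN1r. Qed.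

Lemma ipDl x y z : ip (x + y) z = ip x z + ip y z.
Proof. by rewrite !(ip_conj z) ipDr rmorphD. Qed.

Lemma ipZl a x y : ip (a *: x) y = a^* * ip x y.
Proof. by rewrite !(ip_conj y) ipZr rmorphM. Qed.

Lemma ipBl x y z : ip (x - y) z = ip x z - ip y z.
Proof. by rewrite !(ip_conj z) ipBr rmorphB. Qed.

Lemma ip_inj x y : (forall v, ip v x = ip v y) -> x = y.
Proof.
move=> h; apply/eqP; rewrite -subr_eq0; apply/eqP.
by have [_ _ _] := ip_inner; apply; rewrite ipBr h subrr.
Qed.

Lemma hnorm_ge0 x : 0 <= N x.
Proof. exact: sqrtr_ge0. Qed.

Lemma ipxx x : ip x x = Complex (N x ^+ 2) 0.
Proof.
have [_ _ /(_ x) + _] := ip_inner; rewrite lecE /= => /andP[/eqP i0 r0].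
by rewrite /hnorm sqr_sqrtr //; apply/eqP; rewrite eq_complex /= i0 !eqxx.
Qed.

Lemma hnorm_eq0 x : N x = 0 -> x = 0.
Proof. by move=> h; have [_ _ _] := ip_inner; apply; rewrite ipxx h expr0n. Qed.

(** Positivity of the squared norm of |y|^2 x - <y,x> y; this form needs no division, and |y|^2
    factors out. *)
Lemma cauchy_schwarz x y : cnsq (ip x y) <= N x ^+ 2 * N y ^+ 2.
Proof.
have [y0|y0] := eqVneq (N y) 0.
  by rewrite (hnorm_eq0 y0) ip0r /cnsq /= expr0n addr0 mulr_ge0 ?sqr_ge0.
have y2 : 0 < N y ^+ 2 by rewrite exprn_gt0 // lt_def y0 hnorm_ge0.
have := sqr_ge0 (N (Complex (N y ^+ 2) 0 *: x - ip y x *: y)).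
have -> : N (Complex (N y ^+ 2) 0 *: x - ip y x *: y) ^+ 2 =
    N y ^+ 2 * (N y ^+ 2 * N x ^+ 2 - cnsq (ip x y)).
  set z := (X in N X); have := ipxx z; rewrite {1 2}/z.
  rewrite !(ipBl, ipBr, ipZl, ipZr) !ipxx (ip_conj x y) /cnsq.
  by case: (ip x y) => a b /=; move=> [] /= <- _; ring.
by rewrite pmulr_rge0 // subr_ge0 mulrC.
Qed.

Lemma hnormD x y : N (x + y) <= N x + N y.
Proof.
rewrite -(ler_pXn2r (n := 2)) ?nnegrE ?addr_ge0 ?hnorm_ge0 //.
have -> : N (x + y) ^+ 2 = N x ^+ 2 + N y ^+ 2 + 2 * complex.Re (ip x y).
  have := ipxx (x + y); rewrite !(ipDl, ipDr) !ipxx (ip_conj x y).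
  by case: (ip x y) => a b /= -[<- _]; ring.
suff : complex.Re (ip x y) <= N x * N y by nra.
apply: le_trans (ler_norm _) _.
rewrite -(ler_pXn2r (n := 2)) ?nnegrE ?mulr_ge0 ?hnorm_ge0 // real_normK ?num_real //.
by rewrite exprMn; apply: le_trans (cauchy_schwarz x y); rewrite lerDl sqr_ge0.
Qed.

Lemma hnormZ2 a x : N (a *: x) ^+ 2 = cnsq a * N x ^+ 2.
Proof.
have := ipxx (a *: x); rewrite ipZl ipZr ipxx /cnsq.
by case: a => b c /= -[<- _]; ring.
Qed.

Lemma hnormZ a x : N (a *: x) = Num.sqrt (cnsq a) * N x.
Proof.
apply/eqP; rewrite -(eqrXn2 (n := 2)) ?mulr_ge0 ?hnorm_ge0 ?sqrtr_ge0 //.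
by rewrite hnormZ2 exprMn (@sqr_sqrtr _ (cnsq a)) ?cnsq_ge0.
Qed.

Lemma hnormN x : N (- x) = N x.
Proof.
apply/eqP; rewrite -(eqrXn2 (n := 2)) ?hnorm_ge0 // -scaleN1r hnormZ2.
by rewrite /cnsq /= oppr0 sqrrN expr1n expr0n addr0 mul1r.
Qed.

Lemma hnormB x y : N (x - y) = N (y - x).
Proof. by rewrite -hnormN opprB. Qed.

Definition linear_op (T : H -> H) := forall (a : R[i]) x y, T (a *: x + y) = a *: T x + T y.

Lemma linear_op0 T : linear_op T -> T 0 = 0.
Proof. by move=> h; have := h (-1) 0 0; rewrite !scaleN1r !addNr. Qed.

Lemma linear_opD T : linear_op T -> {morph T : x y / x + y}.
Proof. by move=> h x y; have := h 1 x y; rewrite !scale1r. Qed.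

Lemma linear_opZ T : linear_op T -> forall a, {morph T : x / a *: x}.
Proof. by move=> h a x; have := h a x 0; rewrite (linear_op0 h) !addr0. Qed.

Lemma linear_opB T : linear_op T -> {morph T : x y / x - y}.
Proof.
by move=> h x y; rewrite (linear_opD h) -[in LHS]scaleN1r (linear_opZ h) scaleN1r.
Qed.

Lemma bounded_opP T : bounded_op ip T ->
  exists2 M : R, 0 < M & forall x, N (T x) <= M * N x.
Proof.
move=> [_ [M hM]]; exists (`|M| + 1) => [|x]; first by rewrite ltr_wpDl.
apply: le_trans (hM x) _; rewrite ler_wpM2r ?hnorm_ge0 //.
by have := ler_norm M; lra.
Qed.

Lemma bounded_comp S T : bounded_op ip S -> bounded_op ip T -> bounded_op ip (S \o T).
Proof.
move=> bS bT; have [M M0 hM] := bounded_opP bS; have [K K0 hK] := bounded_opP bT.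
split=> [a x y /=|]; first by rewrite bT.1 bS.1.
exists (M * K) => x /=; apply: le_trans (hM _) _.
by rewrite -mulrA ler_pM2l.
Qed.

Lemma bounded_add S T : bounded_op ip S -> bounded_op ip T ->
  bounded_op ip (fun x => S x + T x).
Proof.
move=> [lS [M hM]] [lT [K hK]]; split=> [a x y|].
  by rewrite lS lT scalerDr addrACA.
exists (M + K) => x; apply: le_trans (hnormD _ _) _.
by rewrite mulrDl lerD.
Qed.

Lemma bounded_scale a T : bounded_op ip T -> bounded_op ip (fun x => a *: T x).
Proof.
move=> [lT [K hK]]; split=> [b x y|].
  by rewrite lT scalerDr !scalerA mulrC.
exists (Num.sqrt (cnsq a) * K) => x.
by rewrite hnormZ -mulrA ler_wpM2l ?sqrtr_ge0.
Qed.

Lemma bounded_id : bounded_op ip id.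
Proof. by split=> //; exists 1 => x; rewrite mul1r. Qed.

Lemma is_adjoint_sym T S : is_adjoint ip T S -> is_adjoint ip S T.
Proof. by move=> h x y; rewrite ip_conj -h -ip_conj. Qed.

Lemma is_adjoint_comp S T S' T' : is_adjoint ip S S' -> is_adjoint ip T T' ->
  is_adjoint ip (S \o T) (T' \o S').
Proof. by move=> hS hT x y /=; rewrite hS hT. Qed.

Lemma adjoint_linear T S : is_adjoint ip T S -> linear_op S.
Proof.
move=> h a x y; apply: ip_inj => v; have h' := is_adjoint_sym h.
by rewrite ipDr ipZr !h' ipDr ipZr.
Qed.

(** By Cauchy-Schwarz |Sx|^2 = <x, TSx> <= |x| M |Sx|; then divide by |Sx|. *)
Lemma adjoint_bound T S (M : R) : is_adjoint ip T S -> 0 <= M ->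
  (forall x, N (T x) <= M * N x) -> forall x, N (S x) <= M * N x.
Proof.
move=> h M0 hM x; have [->|x0] := eqVneq (N (S x)) 0.
  by rewrite mulr_ge0 ?hnorm_ge0.
have Sx0 : 0 < N (S x) by rewrite lt_def x0 hnorm_ge0.
have := cauchy_schwarz x (T (S x)); rewrite h ipxx /cnsq /= expr0n addr0.
rewrite -exprMn ler_pXn2r ?nnegrE ?mulr_ge0 ?sqr_ge0 ?hnorm_ge0 // => le1.
have := ler_wpM2l (hnorm_ge0 x) (hM (S x)); rewrite mulrA => /(le_trans le1).
by rewrite expr2 ler_pM2r // mulrC.
Qed.

(** The difference of the two sides has squared modulus at most [e ^+ 2 * K] for every positive [e].
    The scalar [k] is 1 for plain equalities and a product of expectations for the factorization of
    the state. *)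
Lemma op_conv_ip Tn T v a (k : R[i]) w b : op_conv ip Tn T ->
  (forall n, ip v (Tn n a) = k * ip w (Tn n b)) -> ip v (T a) = k * ip w (T b).
Proof.
move=> cv h; apply/eqP; rewrite -subr_eq0; apply/eqP/cnsq_eq0.
pose K := 2 * (N v * N a) ^+ 2 + 2 * (cnsq k * (N w * N b) ^+ 2).
have K0 : 0 <= K.
  by rewrite addr_ge0 // mulr_ge0 ?sqr_ge0 ?(mulr_ge0 (cnsq_ge0 k)) ?sqr_ge0.
have bnd (e : R) : 0 < e -> cnsq (ip v (T a) - k * ip w (T b)) <= e ^+ 2 * K.
  move=> e0; have [n0 /(_ n0 (leqnn _)) hn] := cv _ e0.
  have -> : ip v (T a) - k * ip w (T b) =
      k * ip w (Tn n0 b - T b) + - ip v (Tn n0 a - T a).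
    by rewrite !ipBr h mulrBr; ring.
  have small u c : cnsq (ip u (Tn n0 c - T c)) <= e ^+ 2 * (N u * N c) ^+ 2.
    apply: le_trans (cauchy_schwarz _ _) _.
    rewrite [leRHS](_ : _ = N u ^+ 2 * (e * N c) ^+ 2); last by ring.
    by rewrite ler_wpM2l ?sqr_ge0 // ler_pXn2r ?nnegrE ?mulr_ge0 ?hnorm_ge0 ?(ltW e0) // hn.
  apply: le_trans (cnsqD _ _) _; rewrite cnsqM.
  have -> : cnsq (- ip v (Tn n0 a - T a)) = cnsq (ip v (Tn n0 a - T a)).
    by rewrite /cnsq; case: (ip _ _) => p q /=; ring.
  have := small v a; have := ler_wpM2l (cnsq_ge0 k) (small w b).
  by rewrite /K; lra.
apply/eqP; rewrite eq_le cnsq_ge0 andbT; apply/ler_addgt0Pr => e e0.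
have K1 : 0 < K + 1 by rewrite ltr_wpDl.
have q0 : 0 < e / (K + 1) by rewrite divr_gt0.
have d0 : 0 < Num.sqrt (e / (K + 1)) by rewrite sqrtr_gt0.
apply: le_trans (bnd _ d0) _; rewrite (sqr_sqrtr (ltW q0)) add0r mulrAC.
by rewrite ler_pdivrMr // ler_pM2l //; lra.
Qed.

Lemma op_conv_compr Tn T S : bounded_op ip S -> op_conv ip Tn T ->
  op_conv ip (fun n => Tn n \o S) (T \o S).
Proof.
move=> /bounded_opP[M M0 hM] cv e e0; have [n0 h] := cv _ (divr_gt0 e0 M0).
exists n0 => n /h hn x /=; apply: le_trans (hn _) _.
apply: le_trans (ler_wpM2l _ (hM x)) _; first by rewrite ltW // divr_gt0.
by rewrite mulrA divfK // gt_eqF.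
Qed.

Lemma op_conv_compl Tn T S : bounded_op ip S -> op_conv ip Tn T ->
  op_conv ip (fun n => S \o Tn n) (S \o T).
Proof.
move=> bS cv e e0; have [M M0 hM] := bounded_opP bS.
have [n0 h] := cv _ (divr_gt0 e0 M0).
exists n0 => n /h hn x /=; rewrite -(linear_opB bS.1).
apply: le_trans (hM _) _; rewrite -ler_pdivlMl //.
by apply: le_trans (hn _) _; rewrite mulrCA mulrA.
Qed.

End InnerProduct.

(** * Signed permutations of a basis *)

Section SignedComposition.
Variables (R : realType) (T : choiceType).
Local Notation H := (l2 R T).

Lemma l2_ext (f g : H) : (forall i, f i = g i) -> f = g.
Proof. by move=> h; apply: val_inj; apply: funext. Qed.

Lemma sum_fset_comp (p : T -> T) (F : T -> R) (A : {fset T}) : injective p ->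
  \sum_(i <- [fset p j | j in A]) F i = \sum_(j <- A) F (p j).
Proof. by move=> pI; rewrite big_imfset //= => i j _ _ /pI. Qed.

Lemma hassum_comp (p q : T -> T) (F : T -> R) l : cancel p q -> cancel q p ->
  hassum F l -> hassum (F \o p) l.
Proof.
move=> pK qK h e e0; have [A hA] := h _ e0; exists [fset q j | j in A] => B hB.
rewrite -(sum_fset_comp _ _ (can_inj pK)) hA //.
apply/fsubsetP => i iA; rewrite -(qK i); apply: in_imfset => /=.
by apply: (fsubsetP hB); apply: in_imfset.
Qed.

Lemma csum_comp (p q : T -> T) (F : T -> R[i]) : cancel p q -> cancel q p ->
  csummable F -> csum (F \o p) = csum F.
Proof.
move=> pK qK [/rsumP a /rsumP b]; rewrite /csum.
by rewrite (rsumE (hassum_comp pK qK a)) (rsumE (hassum_comp pK qK b)).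
Qed.

Variables (s : T -> bool) (p : T -> T).

(** A finite sum of squared moduli becomes one over the image set under [p], so the old bound
    serves. *)
Lemma signed_comp_l2 (pI : injective p) (f : H) :
  (fun i => (-1) ^+ s i * f (p i)) \in @l2_pred R T.
Proof.
have /asboolP[M hM] := l2P f; apply/asboolP; exists M => A.
apply: le_trans (hM [fset p j | j in A]); rewrite sum_fset_comp //.
apply: ler_sum => i _; rewrite cnsqM.
by case: (s i); rewrite /cnsq /= ?expr0n ?oppr0 ?sqrrN ?expr1n ?expr0n ?addr0 ?mul1r.
Qed.

Definition signed_comp (pI : injective p) (f : H) : H := L2 (signed_comp_l2 pI f).

End SignedComposition.

Section SignedCompositionTheory.
Variables (R : realType) (T : choiceType).
Local Notation H := (l2 R T).
Variables (s : T -> bool) (p q : T -> T) (pI : injective p) (qI : injective q).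
Hypotheses (pK : cancel p q) (qK : cancel q p).

Lemma signed_comp_adjoint :
  is_adjoint (@l2_ip R T) (signed_comp s pI) (signed_comp (s \o q) qI).
Proof.
move=> f g; rewrite /l2_ip -(csum_comp qK pK); last exact: l2_csummable.
congr csum; apply: funext => i /=; rewrite qK mulrCA mulrA; congr (_ * _).
by case: (s (q i)) (f (q i)) => [] [a b]; apply/eqP; rewrite eq_complex /=;
  apply/andP; split; apply/eqP; ring.
Qed.

Lemma signed_comp_linear : linear_op (signed_comp s pI : H -> H).
Proof.
move=> a f g; apply: l2_ext => i.
change ((-1) ^+ s i * (a * f (p i) + g (p i)) =
  a * ((-1) ^+ s i * f (p i)) + (-1) ^+ s i * g (p i)).
by rewrite mulrDr mulrCA.
Qed.

(** The adjoint undoes the operator, which is therefore isometric. *)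
Lemma signed_comp_bounded : bounded_op (@l2_ip R T) (signed_comp s pI).
Proof.
split; first exact: signed_comp_linear; exists 1 => f; rewrite mul1r.
rewrite /hnorm signed_comp_adjoint.
suff -> : signed_comp (s \o q) qI (signed_comp s pI f) = f by [].
by apply: l2_ext => i /=; rewrite qK mulrA -signr_addb addbb mul1r.
Qed.

End SignedCompositionTheory.

Section Delta.
Variables (R : realType) (T : choiceType) (i0 : T).

Lemma delta_l2 : (fun i => (i == i0)%:R) \in @l2_pred R T.
Proof.
apply/asboolP; have : summable (fun i => cnsq (R := R) (i == i0)%:R).
  exists (cnsq (i0 == i0)%:R); apply: (@hassum_single _ _ (fun i => cnsq (i == i0)%:R)).
  by move=> i /negbTE ->; rewrite /cnsq /= expr0n addr0.
move=> h; exists (rsum (fun i => cnsq (R := R) (i == i0)%:R)) => A.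
by apply: ler_sum_rsum h => i; apply: cnsq_ge0.
Qed.

Definition delta : l2 R T := L2 delta_l2.

Lemma delta_ip (f : l2 R T) : l2_ip delta f = f i0.
Proof.
rewrite /l2_ip (csum_single (i0 := i0)) /=.
  by rewrite eqxx /= conjC1 mul1r.
by move=> i /negbTE ->; rewrite conjC0 mul0r.
Qed.

End Delta.

(** * Algebras spanned by words in self-adjoint generators *)

Section ClosedSpan.
Variables (R : realType) (H : lmodType R[i]) (ip : H -> H -> R[i]).
Hypothesis ip_hilbert : hilbert_space ip.
Let ip_inner : inner_product ip := ip_hilbert.1.
Local Notation N := (hnorm ip).
Implicit Types (S : opset H) (T X Y : H -> H).

Definition closed_subspace S : Prop :=
  [/\ forall T, S T -> bounded_op ip T,
      forall X Y, S X -> S Y -> S (fun x => X x + Y x),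
      forall a T, S T -> S (fun x => a *: T x) &
      forall Tn T, (forall n, S (Tn n)) -> bounded_op ip T -> op_conv ip Tn T -> S T].

(* The closed linear span, as the least closed subspace: membership is then used by
   choosing a closed subspace, without approximating sequences. *)
Definition cspan S : opset H :=
  fun T => forall S', closed_subspace S' -> (forall X, S X -> S' X) -> S' T.

Definition bounded_set S := forall X, S X -> bounded_op ip X.

Lemma cspan_incl S X : S X -> cspan S X.
Proof. by move=> SX S' _; apply. Qed.

Lemma cspan_closed S : bounded_set S -> closed_subspace (cspan S).
Proof.
move=> Sb; split.
- move=> T hT; apply: (hT (bounded_op ip)) => //; split=> //.
    by move=> X Y; apply: bounded_add.
  by move=> a X; apply: bounded_scale.
- by move=> X Y hX hY S' S'c SS'; have [_ h _ _] := S'c; apply: h; [apply: hX|apply: hY].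
- by move=> a T hT S' S'c SS'; have [_ _ h _] := S'c; apply: h; apply: hT.
- move=> Tn T hT Tb cv S' S'c SS'; have [_ _ _ h] := S'c.
  by apply: h Tb cv => n; apply: hT.
Qed.

Lemma cstar_closed S : cstar_subalg ip S -> closed_subspace S.
Proof. by move=> [? _ [? ? _] _ ?]. Qed.

(** A linear relation between matrix coefficients cuts out a closed subspace; this is how every
    identity below passes from words to whole algebras. *)
Lemma closed_ip_eq v a k w b :
  closed_subspace (fun T => bounded_op ip T /\ ip v (T a) = k * ip w (T b)).
Proof.
split.
- by move=> T [].
- move=> X Y [bX hX] [bY hY]; split; first exact: bounded_add.
  by rewrite /= !(ipDr ip_inner) hX hY mulrDr.
- move=> c T [bT hT]; split; first exact: bounded_scale.
  by rewrite /= !(ipZr ip_inner) hT mulrCA.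
- move=> Tn T h Tb cv; split=> //.
  by apply: (op_conv_ip ip_inner cv) => n; have [] := h n.
Qed.

Lemma cspan_ip_eq S v a k w b T : bounded_set S -> cspan S T ->
  (forall X, S X -> ip v (X a) = k * ip w (X b)) -> ip v (T a) = k * ip w (T b).
Proof.
move=> Sb hT h; apply: (hT _ (closed_ip_eq v a k w b) _).2 => X SX.
by split; [apply: Sb | apply: h].
Qed.

(** One factor at a time: first [Y] runs through the span behind a fixed generator, then [X] runs
    through it in front of the fixed [Y]. *)
Lemma cspan_comp S X Y : bounded_set S -> (forall X Y, S X -> S Y -> S (X \o Y)) ->
  cspan S X -> cspan S Y -> cspan S (X \o Y).
Proof.
move=> Sb SM hX hY; have [cb cD cZ cL] := cspan_closed Sb.
have step X' : S X' -> cspan S (X' \o Y).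
  move=> SX'; have bX' := Sb _ SX'.
  pose L := fun T => bounded_op ip T /\ cspan S (X' \o T).
  suff : L Y by case.
  apply: hY => [|Z SZ]; last by split; [apply: Sb | apply: cspan_incl; apply: SM].
  split.
  - by move=> T [].
  - move=> P Q [bP hP] [bQ hQ]; split; first exact: bounded_add.
    rewrite (_ : _ \o _ = fun x => (X' \o P) x + (X' \o Q) x); first exact: cD.
    by apply: funext => x /=; rewrite (linear_opD bX'.1).
  - move=> c P [bP hP]; split; first exact: bounded_scale.
    rewrite (_ : _ \o _ = fun x => c *: (X' \o P) x); first exact: cZ.
    by apply: funext => x /=; rewrite (linear_opZ bX'.1).
  - move=> Tn T h Tb cv; split=> //.
    apply: (cL (fun n => X' \o Tn n)) => [n||]; first by have [] := h n.
      exact: bounded_comp.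
    exact: op_conv_compl.
pose L := fun T => bounded_op ip T /\ cspan S (T \o Y).
suff : L X by case.
apply: hX => [|Z SZ]; last by split; [apply: Sb | apply: step].
split.
- by move=> T [].
- by move=> P Q [bP hP] [bQ hQ]; split; [apply: bounded_add | apply: cD hP hQ].
- by move=> c P [bP hP]; split; [apply: bounded_scale | apply: cZ hP].
- move=> Tn T h Tb cv; split=> //.
  apply: (cL (fun n => Tn n \o Y)) => [n||]; first by have [] := h n.
    by apply: bounded_comp Tb (cb _ hY).
  by apply: op_conv_compr cv; rewrite //; apply: cb.
Qed.

Lemma hconverges_ip (u : nat -> H) l v c : hconverges ip u l ->
  (forall e : R, 0 < e -> exists n0 : nat, forall n, (n0 <= n)%N -> cnsq (ip v (u n) - c) <= e) ->
  ip v l = c.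
Proof.
move=> ul uc; apply/eqP; rewrite -subr_eq0; apply/eqP/cnsq_eq0.
apply/eqP; rewrite eq_le cnsq_ge0 andbT; apply/ler_addgt0Pr => e e0.
(* Two terms get the bound [e / 4], each doubled by [cnsqD]; the added 1 keeps the divisor
   positive. *)
have v0 : 0 < N v ^+ 2 + 1 by rewrite ltr_wpDl ?sqr_ge0.
have e40 : 0 < e / 4 by rewrite divr_gt0.
have q0 : 0 < e / 4 / (N v ^+ 2 + 1) by rewrite divr_gt0.
have d0 : 0 < Num.sqrt (e / 4 / (N v ^+ 2 + 1)) by rewrite sqrtr_gt0.
have [n1 h1] := ul _ d0; have [n2 h2] := uc _ e40.
have {h1} h1 := h1 _ (leq_maxl n1 n2); have {h2} h2 := h2 _ (leq_maxr n1 n2).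
set n := maxn n1 n2 in h1 h2.
have -> : ip v l - c = ip v (l - u n) + (ip v (u n) - c) by rewrite (ipBr ip_inner) addrA subrK.
apply: le_trans (cnsqD _ _) _.
have : cnsq (ip v (l - u n)) <= e / 4.
  apply: le_trans (cauchy_schwarz ip_inner _ _) _; rewrite (hnormB ip_inner).
  have : N (u n - l) ^+ 2 <= e / 4 / (N v ^+ 2 + 1).
    rewrite -(sqr_sqrtr (ltW q0)) ler_pXn2r ?nnegrE ?hnorm_ge0 ?sqrtr_ge0 //.
    exact: ltW.
  rewrite ler_pdivlMr // => h; apply: le_trans h; rewrite mulrDr mulr1 mulrC.
  by rewrite lerDl sqr_ge0.
by rewrite add0r; lra.
Qed.

(** Adjoints of differences obey the same bounds as the differences, so [Sn n x] is Cauchy for every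
    [x], and by completeness the limits define the adjoint of [T]. This makes a closed span closed
    under adjoints. *)
Lemma adjoint_lim Tn Sn T : (forall n, bounded_op ip (Tn n)) -> bounded_op ip T ->
  op_conv ip Tn T -> (forall n, is_adjoint ip (Tn n) (Sn n)) ->
  exists S : H -> H, [/\ bounded_op ip S, is_adjoint ip T S & op_conv ip Sn S].
Proof.
move=> Tnb Tb cv adj.
have diff_adj n m : is_adjoint ip (fun x => Tn n x - Tn m x) (fun x => Sn n x - Sn m x).
  by move=> x y; rewrite (ipBr ip_inner) (ipBl ip_inner) !adj.
have cauchy x : hcauchy ip (fun n => Sn n x).
  move=> e e0; have x0 : 0 < N x + 1 by rewrite ltr_wpDl ?hnorm_ge0.
  pose d := e / 2 / (N x + 1) / 2.
  have d0 : 0 < d by rewrite !divr_gt0.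
  have [n0 hn0] := cv _ d0; exists n0 => m n hm hn.
  have bnd y : N (Tn m y - Tn n y) <= (d + d) * N y.
    rewrite (_ : Tn m y - Tn n y = (Tn m y - T y) + (T y - Tn n y)); last first.
      by rewrite addrA subrK.
    apply: le_trans (hnormD ip_inner _ _) _; rewrite mulrDl lerD ?hn0 //.
    by rewrite (hnormB ip_inner) hn0.
  have := adjoint_bound ip_inner (diff_adj m n) (ltW (addr_gt0 d0 d0)) bnd x.
  move=> /le_lt_trans; apply.
  have -> : d + d = e / 2 / (N x + 1) by rewrite /d; field; rewrite gt_eqF.
  rewrite mulrAC ltr_pdivrMr //; have := hnorm_ge0 ip x; nra.
have /choice[S hS] : forall x, exists l : H, hconverges ip (fun n => Sn n x) l.
  by move=> x; apply: ip_hilbert.2.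
have SP : is_adjoint ip T S.
  apply: is_adjoint_sym => // y x; rewrite -[RHS]mul1r.
  apply: (hconverges_ip (hS x)) => e e0.
  have [n0 hn0] : exists n0 : nat, forall n, (n0 <= n)%N ->
      cnsq (ip (Tn n y - T y) x) <= e.
    have x0 : 0 < N y ^+ 2 * N x ^+ 2 + 1 by rewrite ltr_wpDl // (mulr_ge0 (sqr_ge0 _) (sqr_ge0 _)).
    have q0 : 0 < e / (N y ^+ 2 * N x ^+ 2 + 1) by rewrite divr_gt0.
    have d0 : 0 < Num.sqrt (e / (N y ^+ 2 * N x ^+ 2 + 1)) by rewrite sqrtr_gt0.
    have [n0 hn0] := cv _ d0; exists n0 => n /hn0 h.
    apply: le_trans (cauchy_schwarz ip_inner _ _) _.
    have : N (Tn n y - T y) ^+ 2 <= e / (N y ^+ 2 * N x ^+ 2 + 1) * N y ^+ 2.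
      by rewrite -(sqr_sqrtr (ltW q0)) -exprMn ler_pXn2r ?nnegrE ?mulr_ge0 ?hnorm_ge0 ?sqrtr_ge0 //.
    move=> /(ler_wpM2r (sqr_ge0 (N x))) /le_trans; apply.
    rewrite -(mulrA (e / _)) mulrAC ler_pdivrMr // ler_pM2l //; lra.
  exists n0 => n /hn0; rewrite mul1r (is_adjoint_sym ip_inner (adj n)).
  by rewrite -(ipBl ip_inner).
have Slin := adjoint_linear ip_inner SP.
have [M M0 hM] := bounded_opP Tb.
exists S; split=> //.
  by split=> //; exists M; apply: (adjoint_bound ip_inner SP (ltW M0) hM).
move=> e e0; have [n0 hn0] := cv _ e0; exists n0 => n /hn0 h x.
have a : is_adjoint ip (fun x => Tn n x - T x) (fun x => Sn n x - S x).
  by move=> y z; rewrite (ipBr ip_inner) (ipBl ip_inner) adj SP.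
exact: (adjoint_bound ip_inner a (ltW e0) h).
Qed.

Definition star_monoid S := [/\ bounded_set S, S id,
  forall X Y, S X -> S Y -> S (X \o Y) &
  forall X, S X -> exists Y, S Y /\ is_adjoint ip X Y].

Lemma cspan_cstar S : star_monoid S -> cstar_subalg ip (cspan S).
Proof.
move=> [Sb S1 SM Sadj]; have [cb cD cZ cL] := cspan_closed Sb.
split=> //; first exact: cspan_incl.
  by split=> // X Y; apply: cspan_comp.
move=> T hT; pose L T := bounded_op ip T /\ exists Y, cspan S Y /\ is_adjoint ip T Y.
suff : L T by case.
apply: hT => [|X SX]; last first.
  split; first exact: Sb.
  by have [Y [SY a]] := Sadj _ SX; exists Y; split=> //; apply: cspan_incl.
split.
- by move=> X [].
- move=> X Y [bX [X' [hX' aX]]] [bY [Y' [hY' aY]]]; split; first exact: bounded_add.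
  exists (fun x => X' x + Y' x); split; first exact: cD.
  by move=> x y; rewrite (ipDr ip_inner) (ipDl ip_inner) aX aY.
- move=> c X [bX [X' [hX' aX]]]; split; first exact: bounded_scale.
  exists (fun x => c^* *: X' x); split; first exact: cZ.
  by move=> x y; rewrite (ipZr ip_inner) (ipZl ip_inner) conjCK aX.
- move=> Tn X h Xb cv; split=> //.
  have /choice[Sn hSn] : forall n, exists Y, cspan S Y /\ is_adjoint ip (Tn n) Y.
    by move=> n; have [] := h n.
  have [Y [bY aY cvY]] := adjoint_lim (fun n => (h n).1) Xb cv (fun n => (hSn n).2).
  by exists Y; split=> //; apply: cL bY cvY => n; have [] := hSn n.
Qed.

(** Moving [Y] to the left argument as its adjoint turns the claim into an identity of matrix
    coefficients in [X] alone, so [X] may be a generator; moving that generator likewise reduces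
    [Y]. *)
Lemma cspan_commute S S' : star_monoid S -> star_monoid S' ->
  (forall X Y, S X -> S' Y -> X \o Y = Y \o X) ->
  commute_sets (cspan S) (cspan S').
Proof.
move=> mS mS' com X Y hX hY; have [Sb _ _ Sadj] := mS; have [S'b _ _ _] := mS'.
have [_ _ _ adjY _] := cspan_cstar mS'; have [Y' [hY' aY]] := adjY _ hY.
apply: funext => x; apply: (ip_inj ip_inner) => v /=; rewrite aY -[RHS]mul1r.
apply: (cspan_ip_eq Sb hX) => Z SZ; rewrite mul1r -aY.
have [Z' [SZ' aZ]] := Sadj _ SZ; rewrite aZ -[RHS]mul1r -[LHS]mul1r.
rewrite [LHS]mul1r; apply: (cspan_ip_eq S'b hY) => W S'W; rewrite mul1r -aZ.
by have /(congr1 (fun f => f x)) /= -> := com _ _ SZ S'W.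
Qed.

Lemma cspan_conj S S' U Us X : bounded_set S' -> unitary ip U Us -> bounded_set S ->
  (forall X, S X -> S' (Us \o X \o U)) -> cspan S X -> cspan S' (Us \o X \o U).
Proof.
move=> S'b [Ub Usb aU UsU UUs] Sb h hX; have [cb cD cZ cL] := cspan_closed S'b.
pose L T := bounded_op ip T /\ cspan S' (Us \o T \o U).
suff : L X by case.
apply: hX => [|Z SZ]; last by split; [apply: Sb | apply: cspan_incl; apply: h].
split.
- by move=> T [].
- move=> P Q [bP hP] [bQ hQ]; split; first exact: bounded_add.
  rewrite (_ : _ \o _ = fun x => (Us \o P \o U) x + (Us \o Q \o U) x); first exact: cD.
  by apply: funext => x /=; rewrite (linear_opD Usb.1).
- move=> c P [bP hP]; split; first exact: bounded_scale.
  rewrite (_ : _ \o _ = fun x => c *: (Us \o P \o U) x); first exact: cZ.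
  by apply: funext => x /=; rewrite (linear_opZ Usb.1).
- move=> Tn T hn Tb cv; split=> //.
  apply: (cL (fun n => Us \o Tn n \o U)) => [n||]; first by have [] := hn n.
    by apply: bounded_comp => //; apply: bounded_comp.
  by apply: op_conv_compr => //; apply: op_conv_compl.
Qed.

Lemma cspan_fix S U Us X : unitary ip U Us -> bounded_set S ->
  (forall X, S X -> Us \o X \o U = X) -> cspan S X -> Us \o X \o U = X.
Proof.
move=> [_ _ aU _ _] Sb h hX; apply: funext => x; apply: (ip_inj ip_inner) => v.
rewrite /= (is_adjoint_sym ip_inner aU) -[RHS]mul1r.
apply: (cspan_ip_eq Sb hX) => Z SZ; rewrite mul1r -(is_adjoint_sym ip_inner aU).
by have /(congr1 (fun f => f x)) /= -> := h _ SZ.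
Qed.

End ClosedSpan.

Section LetterAlgebra.
Variables (R : realType) (H : lmodType R[i]) (ip : H -> H -> R[i]).
Hypothesis ip_hilbert : hilbert_space ip.
Let ip_inner : inner_product ip := ip_hilbert.1.
Variables (K : Type) (E : K -> H -> H).
Hypothesis E_bounded : forall k, bounded_op ip (E k).
Hypothesis E_adj : forall k, is_adjoint ip (E k) (E k).
Implicit Types (P Q : pred K) (w : seq K) (X : H -> H).

Definition word_op w : H -> H := foldr (fun k T => E k \o T) id w.

Lemma word_op_cat w1 w2 : word_op (w1 ++ w2) = word_op w1 \o word_op w2.
Proof. by elim: w1 => //= k w ->. Qed.

Lemma word_op_bounded w : bounded_op ip (word_op w).
Proof. elim: w => [|k w IH]; [exact: bounded_id | exact: bounded_comp]. Qed.

Lemma word_op_adj w : is_adjoint ip (word_op w) (word_op (rev w)).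
Proof.
elim: w => [|k w IH] //; rewrite rev_cons -cats1 word_op_cat.
exact: is_adjoint_comp (E_adj k) IH.
Qed.

Definition words P : opset H := fun T => exists2 w, all P w & T = word_op w.

Lemma words_star P : star_monoid ip (words P).
Proof.
split.
- by move=> _ [w _ ->]; apply: word_op_bounded.
- by exists [::].
- move=> _ _ [w1 h1 ->] [w2 h2 ->]; exists (w1 ++ w2); last by rewrite word_op_cat.
  by rewrite all_cat h1.
- move=> _ [w h ->]; exists (word_op (rev w)); split; last exact: word_op_adj.
  by exists (rev w); rewrite ?all_rev.
Qed.

Lemma words_bounded P : bounded_set ip (words P).
Proof. by have [] := words_star P. Qed.

Definition letter_alg P : opset H := cspan ip (words P).

Lemma letter_alg_cstar P : cstar_subalg ip (letter_alg P).
Proof. by apply: cspan_cstar => //; apply: words_star. Qed.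

Lemma letter_algE P k : P k -> letter_alg P (E k).
Proof. by move=> Pk; apply: cspan_incl; exists [:: k] => //=; rewrite Pk. Qed.

(** A word in letters of both kinds is a product of elements of the two algebras. Compound registers
    thus become letter algebras, whose properties can be checked on words. *)
Lemma letter_alg_gen P Q :
  seteq (cstar_gen ip (opunion (letter_alg P) (letter_alg Q))) (letter_alg (predU P Q)).
Proof.
move=> T; split.
  apply; first exact: letter_alg_cstar.
  move=> X [] hX S Sc hS; apply: (hX _ Sc) => _ [w hw ->]; apply: hS; exists w => //;
    by apply: sub_all hw => k /= ->; rewrite ?orbT.
move=> hT S Sc hS; apply: (hT _ (cstar_closed Sc)) => _ [w hw ->].
have [_ S1 [_ _ SM] _ _] := Sc; elim: w hw => //= k w IH /andP[hk /IH].
apply: SM; apply: hS; case/orP: hk => hk; [left | right]; exact: letter_algE.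
Qed.

Lemma letter_alg_commute P Q : (forall k l, P k -> Q l -> E k \o E l = E l \o E k) ->
  commute_sets (letter_alg P) (letter_alg Q).
Proof.
move=> h; apply: cspan_commute => //; try exact: words_star.
have com1 k w : P k -> all Q w -> E k \o word_op w = word_op w \o E k.
  move=> Pk; elim: w => //= l w IH /andP[Ql /IH e].
  by rewrite -[LHS]/((E k \o E l) \o word_op w) h // -[RHS]/(E l \o (word_op w \o E k)) -e.
move=> _ _ [w1 h1 ->] [w2 h2 ->]; elim: w1 h1 => //= k w1 IH /andP[Pk /IH e].
rewrite -[LHS]/(E k \o (word_op w1 \o word_op w2)) e.
by rewrite -[LHS]/((E k \o word_op w2) \o word_op w1) com1.
Qed.

Lemma letter_alg_ip_eq P (v a : H) (z : R[i]) (v' b : H) T : letter_alg P T ->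
  (forall u, all P u -> ip v (word_op u a) = z * ip v' (word_op u b)) ->
  ip v (T a) = z * ip v' (T b).
Proof.
move=> hT h; apply: (cspan_ip_eq ip_hilbert (@words_bounded P) hT).
by move=> _ [u hu ->]; apply: h.
Qed.

Section Conjugation.
Variables (U Us : H -> H) (p : K -> K).
Hypothesis U_unitary : unitary ip U Us.
Hypothesis E_conj : forall k, Us \o E k \o U = E (p k).

Lemma word_op_conj w : Us \o word_op w \o U = word_op (map p w).
Proof.
have [_ _ _ UsU UUs] := U_unitary.
elim: w => [|k w IH] /=; apply: funext => x /=; first exact: UsU.
by rewrite -IH -E_conj /= UUs.
Qed.

Lemma letter_alg_conj P Q X : (forall k, P k -> Q (p k)) -> letter_alg P X ->
  letter_alg Q (Us \o X \o U).
Proof.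
move=> PQ; apply: (cspan_conj ip_hilbert _ U_unitary); try exact: words_bounded.
move=> _ [w hw ->]; exists (map p w); last exact: word_op_conj.
by rewrite all_map; apply: sub_all hw.
Qed.

Lemma letter_alg_fix P X : (forall k, P k -> p k = k) -> letter_alg P X ->
  Us \o X \o U = X.
Proof.
move=> pid; apply: (cspan_fix ip_hilbert U_unitary); first exact: words_bounded.
move=> _ [w hw ->]; rewrite word_op_conj; congr word_op.
by elim: w hw => //= k w IH /andP[/pid -> /IH ->].
Qed.

End Conjugation.

Lemma unitary_sym U Us : unitary ip U Us -> unitary ip Us U.
Proof. by move=> [bU bUs aU h h']; split=> //; apply: is_adjoint_sym. Qed.

(** The inverse conjugation renames letters by [p'], so both inclusions come from
    [letter_alg_conj]. *)
Lemma letter_alg_conj_img U Us (p p' : K -> K) P Q : unitary ip U Us ->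
  (forall k, Us \o E k \o U = E (p k)) -> cancel p' p -> (forall k, Q (p k) = P k) ->
  seteq (conj_img Us U (letter_alg P)) (letter_alg Q).
Proof.
move=> hU hp pK pQ T; have [_ _ _ UsU UUs] := hU; split.
  by move=> [X [hX ->]]; apply: (letter_alg_conj hU hp _ hX) => k; rewrite pQ.
move=> hT; exists (U \o T \o Us); split; last first.
  by apply: funext => x /=; rewrite !UsU.
apply: (letter_alg_conj (unitary_sym hU) (p := p')) hT => [k|k].
  by rewrite -[in LHS](pK k) -hp; apply: funext => x /=; rewrite !UUs.
by rewrite -pQ pK.
Qed.

(** Reduces acting on a compound register to combinatorics of the permutation [p] of letters. *)
Lemma letter_alg_acts_on U Us (p p' : K -> K) P1 P2 Q1 Q2 : unitary ip U Us ->
  (forall k, Us \o E k \o U = E (p k)) -> cancel p' p ->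
  (forall k, predU P1 P2 (p k) = predU P1 P2 k) -> (forall k, predU Q1 Q2 k -> p k = k) ->
  acts_on ip U Us (letter_alg P1) (letter_alg P2) (letter_alg Q1) (letter_alg Q2).
Proof.
move=> hU hp pK pP pQ; split.
  move=> X [] hX; apply: (letter_alg_fix hU hp _ hX) => k hk;
    by apply: pQ; rewrite /= hk ?orbT.
have gen := letter_alg_gen P1 P2; have img := letter_alg_conj_img hU hp pK pP.
move=> T; rewrite gen -img; split=> -[X [hX ->]]; exists X; split=> //; exact/gen.
Qed.

End LetterAlgebra.

(** * Pauli words on a configuration of positions *)

Section PauliWords.
Variable Pos : eqType.
Local Notation config := (Pos -> bool -> bool).
(* A letter (a, p, b) is the Pauli operator X (b = false) or Z (b = true) of party
   a (false for Alice, true for Bob) at position p.  The configuration (x, z) at a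
   position is the vector X^x Z^z|Bell> with the operators of Alice; there X and Z
   of Bob act as right multiplication by X and Z, which gives [phase]. *)
Local Notation letter := (bool * Pos * bool)%type.
Implicit Types (c d : config) (k : letter) (w : seq letter) (D : pred Pos).

Definition pos k : Pos := k.1.2.

Definition flip k c : config :=
  fun q b => c q b (+) ((q == pos k) && (b == k.2)).

Definition phase k c : bool := (k.1.1 (+) k.2) && c (pos k) (~~ k.2).

(** Operators act on functions by precomposition, so the head of the word, its outermost operator,
    flips the configuration first. *)
Fixpoint word_flip w c : config :=
  if w is k :: w' then word_flip w' (flip k c) else c.

Fixpoint word_phase w c : bool :=
  if w is k :: w' then phase k c (+) word_phase w' (flip k c) else false.

Definition vacuum : config := fun _ _ => false.

Lemma flipC k l c : flip k (flip l c) = flip l (flip k c).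
Proof. by apply: funext => q; apply: funext => b; rewrite /flip addbAC. Qed.

Lemma flipK k : involutive (flip k).
Proof. by move=> c; apply: funext => q; apply: funext => b; rewrite /flip addbK. Qed.

(** The sign reads the bit that is not flipped; hence Pauli operators are self-adjoint
    involutions. *)
Lemma phase_flip k c : phase k (flip k c) = phase k c.
Proof.
rewrite /phase /flip; have -> : (~~ k.2 == k.2) = false by case: k.2.
by rewrite andbF addbF.
Qed.

(** Different positions involve disjoint bits, and at a common position left and right
    multiplication commute. *)
Lemma phaseC k l c : (pos k == pos l) ==> (k.1.1 != l.1.1) ->
  phase k c (+) phase l (flip k c) = phase l c (+) phase k (flip l c).
Proof.
case: k l => [[a p] b] [[a' p'] b']; rewrite /phase /flip /pos /= (eq_sym p').
case: eqP => [->|_] /=; last by rewrite !addbF addbC.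
by case: a a' b b' => [] [] [] [] //= _; rewrite ?addbF ?addbT //;
  case: (c p' true) (c p' false) => [] [].
Qed.

Lemma word_flip_cat w1 w2 c : word_flip (w1 ++ w2) c = word_flip w2 (word_flip w1 c).
Proof. by elim: w1 c => /=. Qed.

Lemma word_phase_cat w1 w2 c :
  word_phase (w1 ++ w2) c = word_phase w1 c (+) word_phase w2 (word_flip w1 c).
Proof. by elim: w1 c => //= k w IH c; rewrite IH addbA. Qed.

Definition word_in D w := all (fun k => D (pos k)) w.

Lemma word_flip_out D w c p : word_in D w -> ~~ D p -> word_flip w c p = c p.
Proof.
move=> + Dp; elim: w c => //= k w IH c /andP[Dk /IH ->].
apply: funext => b; rewrite /flip; case: eqP => [e|]; last by rewrite addbF.
by move: Dp; rewrite e Dk.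
Qed.

Lemma word_local D w c d : word_in D w -> (forall p, D p -> c p = d p) ->
  word_phase w c = word_phase w d /\ forall p, D p -> word_flip w c p = word_flip w d p.
Proof.
elim: w c d => //= k w IH c d /andP[Dk Dw] cd.
have [p Dp|-> h] := IH (flip k c) (flip k d) Dw.
  by apply: funext => b; rewrite /flip cd.
by split=> //; rewrite /phase cd.
Qed.

Variable R : realType.

(** The expectation of a word in the vacuum, as a matrix coefficient at a basis vector. *)
Definition word_state w : R[i] :=
  (-1) ^+ word_phase w vacuum * (word_flip w vacuum == vacuum)%:R.

(** [w1] changes the configuration only inside [D], so [w2] sees the vacuum where it acts, and the
    two together restore the vacuum exactly when each does. *)
Lemma word_state_cat D w1 w2 : word_in D w1 -> word_in (predC D) w2 ->
  word_state (w1 ++ w2) = word_state w1 * word_state w2.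
Proof.
move=> D1 D2; rewrite /word_state word_phase_cat word_flip_cat.
have vac p : predC D p -> word_flip w1 vacuum p = vacuum p by apply: word_flip_out.
have [-> loc] := word_local D2 vac.
have -> : (word_flip w2 (word_flip w1 vacuum) == vacuum) =
    (word_flip w1 vacuum == vacuum) && (word_flip w2 vacuum == vacuum).
  apply/eqP/andP => [h|[/eqP -> /eqP //]]; split; apply/eqP/funext => p.
    have [Dp|/vac //] := boolP (D p).
    by rewrite -[in RHS]h (word_flip_out _ D2) /= ?negbK.
  have [Dp|Dp] := boolP (D p); first by rewrite (word_flip_out _ D2) /= ?negbK.
  by rewrite -loc // h.
by rewrite signr_addb -mulnb natrM; ring.
Qed.

Variable th : Pos -> Pos.
Hypothesis th_inj : injective th.

Definition relocate k : letter := (k.1.1, th (pos k), k.2).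

Lemma flip_relocate k c : flip (relocate k) c \o th = flip k (c \o th).
Proof.
by apply: funext => p; apply: funext => b; rewrite /flip /= (inj_eq th_inj).
Qed.

Lemma word_phase_relocate w c : word_phase (map relocate w) c = word_phase w (c \o th).
Proof. by elim: w c => //= k w IH c; rewrite IH flip_relocate. Qed.

Lemma word_flip_relocate w c : word_flip (map relocate w) c \o th = word_flip w (c \o th).
Proof. by elim: w c => //= k w IH c; rewrite IH flip_relocate. Qed.

(** Pulling configurations back along [th] intertwines the two words and preserves the vacuum;
    positions outside the range of [th] are never flipped. *)
Lemma word_state_relocate w : word_state (map relocate w) = word_state w.
Proof.
rewrite /word_state word_phase_relocate; congr (_ * (nat_of_bool _)%:R).
apply/eqP/eqP => [h|h]; first by rewrite -[LHS](word_flip_relocate w vacuum) h.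
apply: funext => p; have [[q ->]|nq] := pselect (exists q, p = th q).
  by rewrite -[LHS]/((word_flip _ _ \o th) q) word_flip_relocate h.
apply: (@word_flip_out (fun p => `[< exists q, p = th q >])); last exact/asboolPn.
rewrite /word_in all_map; apply/allP => k _ /=; apply/asboolP; by exists (pos k).
Qed.

End PauliWords.

(** * Sites, positions and the embezzling permutation *)

(* (register, Bell type, number): the first component is [false] for register 1,
   and the sites [(false, true, n)] are those initially in a Bell pair. *)
Definition Site := (bool * bool * nat)%type.

(* [inl n] is shared by the two halves of the Bell pair n; at [inr (a, s)] only the
   party a acts, which makes the vacuum maximally mixed there. *)
Definition Position := (nat + bool * Site)%type.

Definition initial_position (a : bool) (s : Site) : Position :=
  if s is (false, true, n) then inl n else inr (a, s).

(** The expectation of a word in [psi'] will be that in [psi] of the word with each site [s] moved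
    to [embezzle s]. Type [true] sites of register 1 take the even Bell pairs, those of register 2
    the odd ones; the type [false] sites of register 2 then cover both types of that register,
    according to the parity of [n]. *)
Definition embezzle (s : Site) : Site :=
  match s with
  | (r, true, n) => (false, true, r + n.*2)%N
  | (false, false, n) => (false, false, n)
  | (true, false, n) => (true, ~~ odd n, n./2)
  end.

Definition unembezzle (s : Site) : Site :=
  match s with
  | (false, true, n) => (odd n, true, n./2)
  | (false, false, n) => (false, false, n)
  | (true, t, n) => (true, false, ~~ t + n.*2)%N
  end.

Lemma embezzleK : cancel embezzle unembezzle.
Proof.
move=> [[[] []] n] //=; rewrite ?add0n ?add1n /= ?odd_double ?doubleK ?uphalf_double //.
by rewrite negbK odd_double_half.
Qed.

Lemma unembezzleK : cancel unembezzle embezzle.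
Proof.
move=> [[[] []] n] //=; rewrite ?add0n ?add1n /= ?odd_double ?doubleK ?uphalf_double //.
by rewrite odd_double_half; case: odd.
Qed.

Definition shift_reg (r : bool) (s : Site) : Site := (r (+) s.1.1, s.1.2, s.2).

Lemma shift_regK r : involutive (shift_reg r).
Proof. by move=> [[r' t] n]; rewrite /shift_reg /= addKb. Qed.

Lemma initial_position_inj a : injective (initial_position a).
Proof. by move=> [[[] []] n] [[[] []] m] //= [->]. Qed.

(* The renaming of positions under which register r after embezzlement matches
   register 1 before. *)
Definition reposition (r : bool) (p : Position) : Position :=
  match p with
  | inl n => inl (r + n.*2)%N
  | inr (a, s) => inr (a, embezzle (shift_reg r s))
  end.

Lemma reposition_inj r : injective (reposition r).
Proof.
move=> [n|[a s]] [m|[b t]] //=.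
  by move=> [e]; have /double_inj -> := addnI e.
move=> [->] e; have e' : embezzle (shift_reg r s) = embezzle (shift_reg r t) by [].
by rewrite (inv_inj (shift_regK r) (can_inj embezzleK e')).
Qed.

(** Bell pair n goes to pair r + 2n at the same position for both parties, and uncorrelated sites go
    to uncorrelated ones. *)
Lemma initial_position_embezzle a r s : s.1.1 = false ->
  initial_position a (embezzle (shift_reg r s)) = reposition r (initial_position a s).
Proof. by move: s => [[r' []] n] /= ->; case: r. Qed.

(** XX and ZZ stabilize the Bell state, while XZ and ZX send it to an orthogonal vector. *)
Lemma word_state_pair (Pos : eqType) (R : realType) (p : Pos) (b b' : bool) :
  word_state R [:: (false, p, b); (true, p, b')] = (b == b')%:R.
Proof.
rewrite /word_state /= /phase /= andbF addbF /flip /pos /vacuum /= eqxx /=.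
(* The sign can be nontrivial only for distinct letters, where the overlap vanishes. *)
have -> : (~~ b') && (~~ b' == b) = (b' != true) && (b != b') by case: b b' => [] [].
have [<-|bb'] := eqVneq b b'.
  rewrite andbF mul1r; congr (nat_of_bool _)%:R; apply/eqP/funext => q; apply/funext => d.
  by rewrite addbb.
rewrite [X in _ * X%:R](_ : _ = 0%N) ?mulr0 //; apply/eqP; rewrite eqb0; apply/eqP.
move=> /(congr1 (fun c => c p b)); rewrite !eqxx (negbTE bb') //.
Qed.

(** * Real combinations of anticommuting involutions *)

Section SelfAdjointInvolutions.
Variables (R : realType) (H : lmodType R[i]) (ip : H -> H -> R[i]).
Hypothesis ip_inner : inner_product ip.

Lemma involution_isometry S x : is_adjoint ip S S -> involutive S ->
  hnorm ip (S x) = hnorm ip x.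
Proof. by move=> aS SK; rewrite /hnorm aS SK. Qed.

Variables (S T : H -> H) (c d : R[i]).
Hypotheses (S_lin : linear_op S) (T_lin : linear_op T).
Hypotheses (S_adj : is_adjoint ip S S) (T_adj : is_adjoint ip T T).
Hypotheses (c_real : c^* = c) (d_real : d^* = d).

Definition combination (x : H) : H := c *: S x + d *: T x.

Lemma combination_adjoint : is_adjoint ip combination combination.
Proof.
move=> x y; rewrite /combination !(ipDr ip_inner, ipDl ip_inner, ipZr ip_inner, ipZl ip_inner).
by rewrite c_real d_real S_adj T_adj.
Qed.

(** Anticommutation cancels the cross terms of the square, leaving c^2 + d^2. *)
Lemma combination_involutive : involutive S -> involutive T ->
  (forall x, S (T x) = - T (S x)) -> c ^+ 2 + d ^+ 2 = 1 -> involutive combination.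
Proof.
move=> SK TK ST cd x; rewrite /combination (linear_opD S_lin) (linear_opD T_lin).
rewrite !(linear_opZ S_lin) !(linear_opZ T_lin) SK TK ST !scalerDr !scalerA !scalerN.
by rewrite (mulrC d c) addrA subrK -scalerDl -!expr2 cd scale1r.
Qed.

End SelfAdjointInvolutions.

(** * The model *)

Section Model.
Variable R : realType.

(** Injectivity is imposed on each party separately: a Bell pair is a position shared by a site of
    Alice and one of Bob. *)
Definition injective_labels (g : bool -> Site -> Position) : bool :=
  `[< forall a, injective (g a) >].

Definition Labelling := {g | injective_labels g}.

Definition Index := (Labelling * (Position -> bool -> bool))%type.

Local Notation H := (l2 R Index).
Local Notation ip := (@l2_ip R Index).

Definition SiteLetter := (bool * Site * bool)%type.

Implicit Types (g : Labelling) (k : SiteLetter) (w : seq SiteLetter).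

Definition locate g k : bool * Position * bool := (k.1.1, val g k.1.1 k.1.2, k.2).

Definition pauli_index k (i : Index) : Index := (i.1, flip (locate i.1 k) i.2).

Lemma pauli_indexK k : involutive (pauli_index k).
Proof. by move=> [g c]; rewrite /pauli_index /= flipK. Qed.

Definition pauli k : H -> H :=
  signed_comp (fun i : Index => phase (locate i.1 k) i.2) (inv_inj (pauli_indexK k)).

Lemma pauli_bounded k : bounded_op ip (pauli k).
Proof.
exact: signed_comp_bounded (inv_inj (pauli_indexK k)) (pauli_indexK k) (pauli_indexK k).
Qed.

Lemma pauli_adj k : is_adjoint ip (pauli k) (pauli k).
Proof.
have h := signed_comp_adjoint (fun i : Index => phase (locate i.1 k) i.2)
  (inv_inj (pauli_indexK k)) (inv_inj (pauli_indexK k)) (pauli_indexK k) (pauli_indexK k) (R := R).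
move: h; congr (is_adjoint _ _ _); apply: funext => x; apply: l2_ext => i /=.
by rewrite phase_flip.
Qed.

Lemma pauliK k : involutive (pauli k).
Proof.
move=> x; apply: l2_ext => i /=.
by rewrite pauli_indexK phase_flip mulrA -signr_addb addbb mul1r.
Qed.

(** Every labelling puts distinct sites of one party at distinct positions, so [phaseC] applies. *)
Lemma pauli_commute k l : (k.1.1 == l.1.1) ==> (k.1.2 != l.1.2) ->
  pauli k \o pauli l = pauli l \o pauli k.
Proof.
move=> kl; apply: funext => x; apply: l2_ext => -[g c] /=.
rewrite !mulrA -!signr_addb /pauli_index /= flipC phaseC //.
rewrite /pos /=; apply/implyP => /eqP e; apply: contraTN kl => /eqP e1.
have /asboolP gI := valP g; rewrite e1 eqxx /= negbK; apply/eqP.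
by apply: (gI l.1.1); rewrite -[RHS]e e1.
Qed.

Lemma pauli_anticommute a s b x :
  pauli (a, s, b) (pauli (a, s, ~~ b) x) = - pauli (a, s, ~~ b) (pauli (a, s, b) x).
Proof.
apply: l2_ext => -[g c].
set k := (a, s, b); set l := (a, s, ~~ b).
change ((-1) ^+ phase (locate g k) c * ((-1) ^+ phase (locate g l) (flip (locate g k) c)
    * x (g, flip (locate g l) (flip (locate g k) c))) =
  - ((-1) ^+ phase (locate g l) c * ((-1) ^+ phase (locate g k) (flip (locate g l) c)
    * x (g, flip (locate g k) (flip (locate g l) c)))) :> R[i]).
rewrite !mulrA -!signr_addb flipC -mulNr; congr (_ * _).
(* The minus sign becomes one more bit of the exponent, leaving a Boolean identity. *)
rewrite -[in RHS]mulN1r -[X in X * _](expr1 (-1)) -[1%N]/(nat_of_bool true) -signr_addb.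
congr (_ ^+ nat_of_bool _); rewrite /phase /flip /pos /= eqxx !negbK.
by case: a b (c _ _) (c _ _) @k @l => [] [] [] [].
Qed.

Lemma relabel_subproof a (p : Site -> Site) g : injective p ->
  injective_labels (fun b => if b == a then val g b \o p else val g b).
Proof.
move=> pI; apply/asboolP => b; have /asboolP gI := valP g.
by case: ifP => _; [apply: inj_comp (gI b) pI | apply: gI].
Qed.

Definition relabel a (p : Site -> Site) (pI : injective p) (i : Index) : Index :=
  (exist injective_labels _ (relabel_subproof a i.1 pI), i.2).

Definition move a (p : Site -> Site) k : SiteLetter :=
  (k.1.1, if k.1.1 == a then p k.1.2 else k.1.2, k.2).

Lemma locate_relabel a p (pI : injective p) i k :
  locate (relabel a pI i).1 k = locate i.1 (move a p k).
Proof. by rewrite /locate /move /=; case: eqP. Qed.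

Lemma relabelK a p q (pI : injective p) (qI : injective q) : cancel q p ->
  cancel (relabel a pI) (relabel a qI).
Proof.
move=> qK [g c]; congr (_, _); apply: val_inj; apply: funext => b /=.
by case: eqP => // _; apply: funext => s /=; rewrite qK.
Qed.

Lemma moveK a p q : cancel p q -> cancel (move a p) (move a q).
Proof. by move=> pK [[b s] d]; rewrite /move /=; case: eqP => //= _; rewrite pK. Qed.

Section RelabelOperator.
Variables (a : bool) (p q : Site -> Site) (pK : cancel p q) (qK : cancel q p).
Let pI := can_inj pK.
Let qI := can_inj qK.

(** Precomposition uses the inverse [q], so that conjugation moves a letter at [s] to [p s]. *)
Definition relabel_op : H -> H :=
  signed_comp (fun _ => false) (can_inj (relabelK a qI pI pK)).

Definition relabel_inv : H -> H :=
  signed_comp (fun _ => false) (can_inj (relabelK a pI qI qK)).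

Lemma relabel_unitary : unitary ip relabel_op relabel_inv.
Proof.
have K1 := relabelK a qI pI pK; have K2 := relabelK a pI qI qK; split.
- exact: signed_comp_bounded (can_inj K2) K1 K2.
- exact: signed_comp_bounded (can_inj K1) K2 K1.
- exact: (signed_comp_adjoint _ (can_inj (relabelK a qI pI pK))
    (can_inj (relabelK a pI qI qK)) K1 K2).
- by move=> x; apply: l2_ext => i; rewrite /= !mul1r K2.
- by move=> x; apply: l2_ext => i; rewrite /= !mul1r K1.
Qed.

Lemma relabel_pauli k : relabel_inv \o pauli k \o relabel_op = pauli (move a p k).
Proof.
apply: funext => x; apply: l2_ext => i.
change (1 * ((-1) ^+ phase (locate (relabel a pI i).1 k) i.2 *
   (1 * x (relabel a qI (pauli_index k (relabel a pI i))))) =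
  (-1) ^+ phase (locate i.1 (move a p k)) i.2 * x (pauli_index (move a p k) i) :> R[i]).
rewrite !mul1r locate_relabel; congr (_ * x _).
rewrite /pauli_index locate_relabel.
by rewrite -[RHS](relabelK a pI qI qK).
Qed.

End RelabelOperator.

Lemma initial_labelling_subproof : injective_labels initial_position.
Proof. by apply/asboolP; apply: initial_position_inj. Qed.

Definition initial_labelling : Labelling := exist injective_labels _ initial_labelling_subproof.

Definition psi : H := delta R ((initial_labelling, @vacuum Position) : Index).

Lemma word_op_pauli w (x : H) g c : word_op pauli w x (g, c) =
  (-1) ^+ word_phase (map (locate g) w) c * x (g, word_flip (map (locate g) w) c).
Proof.
elim: w c => [|k w IH] c; first by rewrite mul1r.
rewrite -[LHS]/((-1) ^+ phase (locate g k) c * word_op pauli w x (g, flip (locate g k) c)).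
by rewrite IH mulrA -signr_addb.
Qed.

Lemma psi_word w :
  ip psi (word_op pauli w psi) = word_state R (map (locate initial_labelling) w).
Proof.
rewrite delta_ip word_op_pauli; congr (_ * (nat_of_bool _)%:R).
by rewrite /= xpair_eqE eqxx.
Qed.

End Model.

(** * Self-embezzlement *)

Section Embezzlement.
Variable R : realType.
Local Notation H := (l2 R Index).
Local Notation ip := (@l2_ip R Index).
Local Notation pauli := (@pauli R).
Local Notation psi := (@psi R).
Local Notation state w := (ip psi (word_op pauli w psi)).
Implicit Types (k : SiteLetter) (w : seq SiteLetter).

Let ip_hilbert : hilbert_space ip := @l2_hilbert R Index.
Let ip_inner : inner_product ip := ip_hilbert.1.

Definition in_reg (a r : bool) : pred SiteLetter :=
  fun k => (k.1.1 == a) && (k.1.2.1.1 == r).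

Definition reg_alg a r : opset H := letter_alg ip pauli (in_reg a r).

Lemma reg_alg_commute a r a' r' : (a != a') || (r != r') ->
  commute_sets (reg_alg a r) (reg_alg a' r').
Proof.
move=> ne; apply: letter_alg_commute => //; try exact: pauli_bounded; try exact: pauli_adj.
move=> k l /andP[/eqP ka /eqP kr] /andP[/eqP la /eqP lr]; apply: pauli_commute.
rewrite ka la; apply/implyP => /eqP e; move: ne; rewrite e eqxx /=.
by rewrite -kr -lr; apply: contra => /eqP ->.
Qed.

(** Any permutation of the sites of one party qualifies, even across its registers: it keeps the
    party of each letter and fixes the letters of the other party. *)
Lemma reg_acts_on a p q (pK : cancel p q) (qK : cancel q p) :
  acts_on ip (@relabel_op R a p q pK qK) (@relabel_inv R a p q pK qK)
    (reg_alg a false) (reg_alg a true) (reg_alg (~~ a) false) (reg_alg (~~ a) true).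
Proof.
have side k : predU (in_reg a false) (in_reg a true) k = (k.1.1 == a).
  by rewrite /= /in_reg -andb_orr; case: (k.1.2.1.1); rewrite andbT.
apply: (letter_alg_acts_on ip_hilbert (@pauli_bounded R) (@pauli_adj R)
  (relabel_unitary _ _ _ _) (relabel_pauli R a pK qK) (moveK a qK)) => k.
  by rewrite !side.
have na : (~~ a == a) = false by case: (a).
by case: k => [[b s] d] /orP[] /andP[/eqP /= -> _]; rewrite /move /= na.
Qed.

Definition UA : H -> H := relabel_op false embezzleK unembezzleK.
Definition UAs : H -> H := relabel_inv false embezzleK unembezzleK.
Definition UB : H -> H := relabel_op true embezzleK unembezzleK.
Definition UBs : H -> H := relabel_inv true embezzleK unembezzleK.
(** The site-by-site exchange of the two registers, from which the unitaries of the last condition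
    are built. *)
Definition swapK := shift_regK true.
Definition WA : H -> H := relabel_op false swapK swapK.
Definition WAs : H -> H := relabel_inv false swapK swapK.
Definition WB : H -> H := relabel_op true swapK swapK.
Definition WBs : H -> H := relabel_inv true swapK swapK.

(** The two relabellings change different components of a labelling. *)
Lemma UA_UB : UA \o UB = UB \o UA.
Proof.
apply: funext => x; apply: l2_ext => i.
change (1 * (1 * x (relabel true (can_inj unembezzleK) (relabel false (can_inj unembezzleK) i))) =
  1 * (1 * x (relabel false (can_inj unembezzleK) (relabel true (can_inj unembezzleK) i))) :> R[i]).
rewrite !mul1r; congr (x _); congr (_, _); apply: val_inj; apply: funext => b /=.
by case: b.
Qed.

Definition psi' : H := UA (UB psi).

Definition shift_letter r k : SiteLetter := (k.1.1, shift_reg r k.1.2, k.2).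

Definition reg1 : pred SiteLetter := fun k => k.1.2.1.1 == false.

Lemma psi'_word w :
  ip psi' (word_op pauli w psi') = state (map (move true embezzle) (map (move false embezzle) w)).
Proof.
have uA := relabel_unitary R false embezzleK unembezzleK.
have uB := relabel_unitary R true embezzleK unembezzleK.
rewrite -(word_op_conj uB (relabel_pauli R true embezzleK unembezzleK)).
rewrite -(word_op_conj uA (relabel_pauli R false embezzleK unembezzleK)) /=.
have [_ _ aA _ _] := uA; have [_ _ aB _ _] := uB.
by rewrite (is_adjoint_sym ip_inner aB) (is_adjoint_sym ip_inner aA).
Qed.

(** The core of the argument: on letters of register 1, shifting by [r] and embezzling amounts to
    the injective renaming [reposition r] of positions, invisible to [word_state]. The case
    [r = false] says that register 1 is unchanged; with [r = true] it compares the two registers. *)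
Lemma psi'_state r w : all reg1 w ->
  ip psi' (word_op pauli (map (shift_letter r) w) psi') = state w.
Proof.
move=> w1; rewrite psi'_word !psi_word -[RHS](word_state_relocate R (@reposition_inj r)).
congr word_state; rewrite -!map_comp; apply/eq_in_map => -[[a s] b] /(allP w1) /eqP s1.
have e : move true embezzle (move false embezzle (shift_letter r (a, s, b))) =
    (a, embezzle (shift_reg r s), b) by case: (a).
rewrite -[LHS]/(locate initial_labelling (move true embezzle
  (move false embezzle (shift_letter r (a, s, b))))) e.
exact: (congr1 (fun p : Position => (a, p, b)) (initial_position_embezzle a r s1)).
Qed.

Lemma psi'_state_id w : all reg1 w -> ip psi' (word_op pauli w psi') = state w.
Proof.
move=> /(psi'_state false); rewrite map_id_in // => -[[a [[s t] n]] b] _ //.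
Qed.

(** The three words start at disjoint sets of positions. *)
Lemma psi_product u y z : all reg1 u -> all (in_reg false true) y -> all (in_reg true true) z ->
  state (u ++ y ++ z) = state u * state y * state z.
Proof.
move=> hu hy hz; rewrite !psi_word !map_cat -mulrA.
have loc a r w : all (in_reg a r) w -> forall D : pred Position,
    (forall s, s.1.1 = r -> D (initial_position a s)) ->
    word_in D (map (locate initial_labelling) w).
  move=> h D hD; rewrite /word_in all_map; apply: sub_all h => k /andP[/eqP ka /eqP kr].
  by rewrite /= /locate /pos /= ka; apply: hD.
(* The first split separates register 2 from everything else; shared positions belong to register
   1. *)
rewrite (@word_state_cat _ R (fun p => if p is inr (_, s) then ~~ s.1.1 else true)).
- congr (_ * _).
  (* Within register 2 the positions are private, so the second split is by party. *)
  rewrite (@word_state_cat _ R (fun p => if p is inr (a, _) then ~~ a else true)) //.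
    by apply: (loc _ _ _ hy) => -[[[] []] n].
  by apply: (loc _ _ _ hz) => -[[[] []] n].
- rewrite /word_in all_map; apply: sub_all hu => k /eqP.
  by rewrite /locate /pos /=; case: (k.1.2) => [[r []] n] /= ->.
- rewrite /word_in all_cat; apply/andP; split.
    by apply: (loc _ _ _ hy) => -[[[] []] n].
  by apply: (loc _ _ _ hz) => -[[[] []] n].
Qed.

Lemma reg1_alg X : cstar_gen ip (opunion (reg_alg false false) (reg_alg true false)) X ->
  exists2 P : pred SiteLetter, (forall k, P k -> reg1 k) & letter_alg ip pauli P X.
Proof.
move=> hX; exists (predU (in_reg false false) (in_reg true false)).
  by move=> k /orP[] /andP[].
by apply/(letter_alg_gen ip_hilbert (@pauli_bounded R) (@pauli_adj R)).
Qed.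

Let ip_eq := @letter_alg_ip_eq _ _ _ ip_hilbert _ _ (@pauli_bounded R) (@pauli_adj R).

(** The three operators are replaced by words in turn. Each word, once fixed, moves to the left
    argument as its reversal, exposing the next operator. *)
Lemma psi_productE X Y Z :
  cstar_gen ip (opunion (reg_alg false false) (reg_alg true false)) X ->
  reg_alg false true Y -> reg_alg true true Z ->
  ip psi (X (Y (Z psi))) = ip psi (X psi) * ip psi (Y psi) * ip psi (Z psi).
Proof.
move=> /reg1_alg[P P1 hX] hY hZ; rewrite -mulrA mulrC.
apply: (ip_eq hX) => u hu; have {}hu : all reg1 u by apply: sub_all hu.
rewrite (word_op_adj (@pauli_adj R)) mulrAC -mulrA mulrC.
apply: (ip_eq hY) => y hy; rewrite (word_op_adj (@pauli_adj R)) [RHS]mulrAC.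
apply: (ip_eq hZ) => z hz.
rewrite -!(word_op_adj (@pauli_adj R)) -(psi_product hu hy hz).
by rewrite !word_op_cat.
Qed.

Lemma psi'_reg1 X :
  cstar_gen ip (opunion (reg_alg false false) (reg_alg true false)) X ->
  ip psi (X psi) = ip psi' (X psi').
Proof.
move=> /reg1_alg[P P1 hX]; rewrite -[RHS]mul1r; apply: (ip_eq hX) => u hu.
have {}hu : all reg1 u by apply: sub_all hu.
by rewrite mul1r psi'_state_id.
Qed.

(** After reduction to words, one at a time, conjugation by the swap shifts letters to register 2,
    and both sides equal the same expectation in [psi] by [psi'_state]. *)
Lemma psi'_swap X Y : reg_alg false false X -> reg_alg true false Y ->
  ip psi' (X (Y psi')) = ip psi' ((WAs \o X \o WA) ((WBs \o Y \o WB) psi')).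
Proof.
have uA := relabel_unitary R false swapK swapK.
have uB := relabel_unitary R true swapK swapK.
have [_ _ aA _ _] := uA; have [_ _ aB _ _] := uB.
have swapE a w : all (in_reg a false) w ->
    word_op pauli (map (shift_letter true) w) =
    relabel_inv a swapK swapK \o word_op pauli w \o relabel_op a swapK swapK.
  move=> h; rewrite (word_op_conj (relabel_unitary R a swapK swapK) (relabel_pauli R a swapK swapK)).
  by congr word_op; apply/eq_in_map => k /(allP h) /andP[e _]; rewrite /move e.
move=> hX hY; rewrite /= (is_adjoint_sym ip_inner aA) -[RHS]mul1r.
apply: (ip_eq hX) => u hu; rewrite mul1r -(is_adjoint_sym ip_inner aA).
rewrite -[RHS]/(ip psi' ((WAs \o word_op pauli u \o WA) (WBs (Y (WB psi'))))) -(swapE _ _ hu).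
rewrite !(word_op_adj (@pauli_adj R)) (is_adjoint_sym ip_inner aB) -[RHS]mul1r.
apply: (ip_eq hY) => y hy; rewrite mul1r -(is_adjoint_sym ip_inner aB).
rewrite -!(word_op_adj (@pauli_adj R)).
rewrite -[RHS]/(ip psi' (word_op pauli (map (shift_letter true) u)
  ((WBs \o word_op pauli y \o WB) psi'))) -(swapE _ _ hy).
rewrite -[LHS]/(ip psi' ((word_op pauli u \o word_op pauli y) psi')).
rewrite -[RHS]/(ip psi' ((word_op pauli _ \o word_op pauli _) psi')).
have huy : all reg1 (u ++ y).
  by rewrite all_cat; apply/andP; split; [apply: sub_all hu | apply: sub_all hy] => k /andP[].
by rewrite -!word_op_cat -map_cat (psi'_state true huy) psi'_state_id.
Qed.

Lemma bell_correlation b b' :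
  ip psi (pauli (false, (false, true, 0%N), b) (pauli (true, (false, true, 0%N), b') psi)) =
    (b == b')%:R.
Proof.
have := psi_word R [:: (false, (false, true, 0%N), b); (true, (false, true, 0%N), b')].
by rewrite /= word_state_pair.
Qed.

(** The standard optimal observables (Z + X)/√2 and (Z - X)/√2 of Bob on Bell pair 0; [sqrtC 2 / 2]
    is 1/√2. *)
Definition chsh_b (sgn : bool) : H -> H :=
  combination (pauli (true, (false, true, 0%N), true)) (pauli (true, (false, true, 0%N), false))
    (sqrtC 2 / 2) ((-1) ^+ sgn * (sqrtC 2 / 2)).

Lemma pauli_linear k : linear_op (pauli k).
Proof. exact: (pauli_bounded R k).1. Qed.

Lemma sqrtC2_real : (sqrtC 2 / 2 : R[i])^* = sqrtC 2 / 2.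
Proof. by rewrite geC0_conj // divr_ge0 // sqrtC_ge0. Qed.

Lemma sign_sqrtC2_real (sgn : bool) :
  ((-1) ^+ sgn * (sqrtC 2 / 2) : R[i])^* = (-1) ^+ sgn * (sqrtC 2 / 2).
Proof. by rewrite rmorphM rmorph_sign /= sqrtC2_real. Qed.

Lemma chsh_b_adjoint sgn : is_adjoint ip (chsh_b sgn) (chsh_b sgn).
Proof.
apply: combination_adjoint => //; try exact: pauli_adj.
  exact: sqrtC2_real.
exact: sign_sqrtC2_real.
Qed.

Lemma chsh_b_norm sgn x : hnorm ip (chsh_b sgn x) = hnorm ip x.
Proof.
apply: involution_isometry; first exact: chsh_b_adjoint.
apply: combination_involutive; try exact: pauli_linear; try exact: pauliK.
  exact: (pauli_anticommute true _ true).
by rewrite !exprMn sqrr_sign mul1r sqrtCK; field.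
Qed.

Lemma chsh_b_alg sgn : reg_alg true false (chsh_b sgn).
Proof.
have [_ _ [D Z _] _ _] := letter_alg_cstar ip_hilbert (@pauli_bounded R) (@pauli_adj R)
  (in_reg true false).
by apply: D; apply: Z; apply: letter_algE.
Qed.

(** Only the ZZ and XX correlations survive, so each of the four signed terms contributes 1/√2. *)
Lemma chsh_value :
  let a b := pauli (false, (false, true, 0%N), b) in
  ip psi (a true (chsh_b false psi) + a true (chsh_b true psi)
    + a false (chsh_b false psi) - a false (chsh_b true psi)) = 2 * sqrtC 2.
Proof.
rewrite /chsh_b /combination /=.
rewrite !(linear_opD (pauli_linear _)) !(linear_opZ (pauli_linear _)).
rewrite !(ipBr ip_inner, ipDr ip_inner, ipZr ip_inner) !bell_correlation /=.
by rewrite expr0 expr1; field.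
Qed.

End Embezzlement.

Theorem theorem1p2 (R : realType) :
  exists (H : lmodType R[i]) (ip : H -> H -> R[i])
         (A1 B1 A2 B2 : opset H) (psi : H)
         (UA UAs UB UBs : H -> H),
    (* Hilbert space, four pairwise commuting unital C*-subalgebras *)
    hilbert_space ip /\
    (cstar_subalg ip A1 /\ cstar_subalg ip B1 /\
     cstar_subalg ip A2 /\ cstar_subalg ip B2) /\
    (commute_sets A1 B1 /\ commute_sets A1 A2 /\ commute_sets A1 B2 /\
     commute_sets B1 A2 /\ commute_sets B1 B2 /\ commute_sets A2 B2) /\
    (* unit vector *)
    ip psi psi = 1 /\
    (* U_A on (A1,A2), U_B on (B1,B2), commuting *)
    (unitary ip UA UAs /\ acts_on ip UA UAs A1 A2 B1 B2 /\
     unitary ip UB UBs /\ acts_on ip UB UBs B1 B2 A1 A2 /\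
     UA \o UB = UB \o UA) /\
    let psi' := UA (UB psi) in
    (* (0) maximal CHSH violation on (A1,B1) *)
    (exists a0 a1 b0 b1 : H -> H,
        (A1 a0 /\ A1 a1 /\ B1 b0 /\ B1 b1) /\
        (is_adjoint ip a0 a0 /\ is_adjoint ip a1 a1 /\
         is_adjoint ip b0 b0 /\ is_adjoint ip b1 b1) /\
        ((forall x, hnorm ip (a0 x) <= hnorm ip x) /\
         (forall x, hnorm ip (a1 x) <= hnorm ip x) /\
         (forall x, hnorm ip (b0 x) <= hnorm ip x) /\
         (forall x, hnorm ip (b1 x) <= hnorm ip x)) /\
        ip psi (a0 (b0 psi) + a0 (b1 psi) + a1 (b0 psi) - a1 (b1 psi))
          = 2 * sqrtC 2) /\
    (* (1) product state over (A1,B1), A2, B2 *)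
    (forall X Y Z, cstar_gen ip (opunion A1 B1) X -> A2 Y -> B2 Z ->
        ip psi (X (Y (Z psi)))
          = ip psi (X psi) * ip psi (Y psi) * ip psi (Z psi)) /\
    (* (2) register (A1,B1) unchanged *)
    (forall X, cstar_gen ip (opunion A1 B1) X ->
        ip psi (X psi) = ip psi' (X psi')) /\
    (* (3) *)
    (exists WA WAs WB WBs : H -> H,
        unitary ip WA WAs /\ acts_on ip WA WAs A1 A2 B1 B2 /\
        unitary ip WB WBs /\ acts_on ip WB WBs B1 B2 A1 A2 /\
        seteq (conj_img WAs WA A1) A2 /\
        seteq (conj_img WBs WB B1) B2 /\
        (forall X Y, A1 X -> B1 Y ->
           ip psi' (X (Y psi'))
             = ip psi' ((WAs \o X \o WA) ((WBs \o Y \o WB) psi')))).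
Proof.
have hil := @l2_hilbert R Index.
have cstar a r := letter_alg_cstar hil (@pauli_bounded R) (@pauli_adj R) (in_reg a r).
have swap_img a : seteq (conj_img (relabel_inv a swapK swapK) (relabel_op a swapK swapK)
    (@reg_alg R a false)) (@reg_alg R a true).
  apply: (letter_alg_conj_img hil (@pauli_bounded R) (@pauli_adj R)
    (relabel_unitary R a swapK swapK) (relabel_pauli R a swapK swapK) (moveK a swapK)) => k.
  (* The swap toggles the register of the letters of party [a]; letters of the other party lie in
     neither predicate. *)
  rewrite /in_reg /move /=; case: eqP => //= _.
  by case: (k.1.2.1.1).
exists (l2 R Index), (@l2_ip R Index), (@reg_alg R false false), (@reg_alg R true false),
  (@reg_alg R false true), (@reg_alg R true true), (psi R), (@UA R), (@UAs R), (@UB R), (@UBs R).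
split=> //; split; first by split; [|split; [|split]]; apply: cstar.
split; first by do ![split | exact: reg_alg_commute].
split; first by rewrite delta_ip /= eqxx.
split.
  split; first exact: relabel_unitary; split; first exact: reg_acts_on.
  split; first exact: relabel_unitary; split; first exact: reg_acts_on.
  exact: UA_UB.
move=> psi1; split.
  (* A single Bell pair suffices, on which Alice measures Z and X. *)
  pose s0 : Site := (false, true, 0%N).
  exists (@pauli R (false, s0, true)), (@pauli R (false, s0, false)), (@chsh_b R false), (@chsh_b R true).
  have a_alg b : @reg_alg R false false (@pauli R (false, s0, b)).
    exact: letter_algE.
  split; first by do ![split]; [exact: a_alg | exact: a_alg | exact: chsh_b_alg | exact: chsh_b_alg].
  split.
    by do ![split]; [exact: pauli_adj|exact: pauli_adj|exact: chsh_b_adjoint|exact: chsh_b_adjoint].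
  split; last exact: chsh_value.
  have pn k x : hnorm (@l2_ip R Index) (@pauli R k x) <= hnorm (@l2_ip R Index) x.
    by rewrite (involution_isometry x (@pauli_adj R k) (@pauliK R k)).
  by do ![split] => // x; rewrite chsh_b_norm.
split; first by move=> X Y Z; apply: psi_productE.
split; first by move=> X; apply: psi'_reg1.
exists (@WA R), (@WAs R), (@WB R), (@WBs R).
split; first exact: relabel_unitary; split; first exact: reg_acts_on.
split; first exact: relabel_unitary; split; first exact: reg_acts_on.
split; first exact: swap_img.
split; first exact: swap_img.
by move=> X Y; apply: psi'_swap.
Qed.
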